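(* Let $N, k, n$ be nonnegative integers. Let $G$ be a bipartite graph with boundary embedded in a disc, such that all of the boundary vertices are white. Suppose $G$ has $N+k$ black vertices $b_1, \dots, b_{N+k}$ (all internal), $N$ internal white vertices $w_1, \dots, w_N$, and $n$ boundary vertices $w_{N+1}, \dots, w_{N+n}$, the boundary vertices having that circular order. Then the $\binom{n}{k}$ numbers $\mathbb{D}(G,I)$, as $I$ ranges through the $k$-element subsets of $\partial G$, are either all zero or the Plücker coordinates of a point on the Grassmannian $G(k,n)$.
   Context: Graphs are finite and simple. A bipartite graph has its vertices coloured black and white so that every edge joins a black vertex to a white vertex. A graph with boundary is a finite graph $G$ with a specified subset $\partial G$ of its vertices, equipped with a circular ordering. The vertices in $\partial G$ are the boundary vertices; the other vertices are the internal vertices. A graph with boundary is embedded in a disc if $G$ is embedded (without edge crossings) in a closed planar disc $D$ such that the vertices of $\partial G$ lie on the boundary circle $\partial D$, in their specified circular order. A perfect matching of a graph with boundary $G$ is a collection $M$ of edges of $G$ such that each internal vertex is contained in exactly one edge of $M$ and each boundary vertex is contained in at most one edge of $M$. For such $M$, $\partial M$ denotes the set of boundary vertices contained in edges of $M$. For $I \subseteq \partial G$, $\mathbb{D}(G,I)$ denotes the number of perfect matchings $M$ of $G$ with $\partial M = I$. $G(k,n)$ is the Grassmannian of $k$-dimensional linear subspaces of $\mathbb{R}^n$. The Plücker coordinates of the row span of a $k\times n$ real matrix $L$ of rank $k$ are its maximal minors $\det L_I$ (with $L_I$ the submatrix on the columns indexed by the $k$-element set $I$, in increasing order), defined up to a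 common nonzero scalar. The boundary vertex $w_{N+j}$ corresponds to the column index $j \in \{1,\dots,n\}$. *)

(* Defs.v *)
From HB Require Import structures.
From mathcomp Require Import all_boot all_order all_algebra.
From mathcomp Require Import all_classical all_reals all_analysis.

Set Implicit Arguments.
Unset Strict Implicit.
Unset Printing Implicit Defensive.

Import Order.TTheory GRing.Theory Num.Theory.
Import numFieldNormedType.Exports.

Local Open Scope ring_scope.

(* The circular ordering of the [n] boundary vertices is given by an
   enumeration [bdry] of them, listed once around from some starting point. *)
Record bgraph (n : nat) : Type := BGraph {
  vertex :> finType;
  adj : rel vertex;
  bdry : 'I_n -> vertex;
  adj_sym : symmetric adj;
  adj_irr : irreflexive adj;
  bdry_inj : injective bdry
}.

Section Graph.
Variables (n : nat) (G : bgraph n).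

Definition edges : {set {set G}} :=
  [set e | [exists x, exists y, adj x y && (e == [set x; y])]].

Definition boundary : {set G} := [set bdry G j | j in [set: 'I_n]].

Definition two_colouring (B : {set G}) : Prop :=
  forall x y : G, adj x y -> (x \in B) != (y \in B).

Definition perfect_matching (M : {set {set G}}) : bool :=
  [&& M \subset edges,
      [forall v in ~: boundary, #|[set e in M | v \in e]| == 1%N]
    & [forall v in boundary, #|[set e in M | v \in e]| <= 1]%N].

Definition matching_boundary (M : {set {set G}}) : {set G} :=
  [set v in boundary | [exists e in M, v \in e]].

Definition dimers (I : {set G}) : nat :=
  #|[set M | perfect_matching M & matching_boundary M == I]|.

End Graph.

Section Embedding.
Variables (R : realType) (n : nat) (G : bgraph n).

(* [pos] places the vertices and [arc e] is a parametrization of the edge [e]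
   by the unit interval.  Internal vertices and edges may touch the boundary
   circle.  The boundary vertices are met in their order when the circle is
   traversed once counterclockwise; since the disc may be reflected, the
   existence of an embedding does not depend on this choice of direction. *)
Record is_disc_embedding (c : R * R) (r : R) (pos : G -> R * R)
    (arc : {set G} -> R -> R * R) : Prop := IsDiscEmbedding {
  emb_radius : 0 < r;
  emb_pos_inj : injective pos;
  emb_pos_disc : forall v : G,
    ((pos v).1 - c.1) ^+ 2 + ((pos v).2 - c.2) ^+ 2 <= r ^+ 2;
  emb_arc_cont : forall e : {set G}, e \in edges G ->
    ({within `[0, 1], continuous (arc e)})%classic;
  emb_arc_inj : forall e : {set G}, e \in edges G ->
    {in `[0, 1] &, injective (arc e)};
  emb_arc_disc : forall (e : {set G}) (t : R), e \in edges G -> t \in `[0, 1] ->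
    ((arc e t).1 - c.1) ^+ 2 + ((arc e t).2 - c.2) ^+ 2 <= r ^+ 2;
  emb_arc_ends : forall e : {set G}, e \in edges G ->
    exists x y : G, [/\ e = [set x; y], arc e 0 = pos x & arc e 1 = pos y];
  emb_arc_vertex : forall (e : {set G}) (t : R) (v : G),
    e \in edges G -> t \in `]0, 1[ -> arc e t <> pos v;
  emb_arc_disjoint : forall (e f : {set G}) (s t : R),
    e \in edges G -> f \in edges G -> e != f ->
    s \in `]0, 1[ -> t \in `]0, 1[ -> arc e s <> arc f t;
  emb_bdry : exists theta : 'I_n -> R,
    [/\ forall i j : 'I_n, (i < j)%N -> theta i < theta j,
        forall i j : 'I_n, theta j < theta i + 2 * pi
      & forall j : 'I_n,
          pos (bdry G j) = (c.1 + r * cos (theta j), c.2 + r * sin (theta j))]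
}.

Definition embedded_in_disc : Prop :=
  exists (c : R * R) (r : R) (pos : G -> R * R) (arc : {set G} -> R -> R * R),
    is_disc_embedding c r pos arc.

End Embedding.

Section Pluecker.
Variables (F : fieldType) (k n : nat).

(* [enum_val] lists the elements of [I] in increasing order. *)
Definition minor (L : 'M[F]_(k, n)) (I : {set 'I_n}) (hI : #|I| = k) : F :=
  \det (colsub (fun j : 'I_k => enum_val (cast_ord (esym hI) j)) L).

Definition row_span (L : 'M[F]_(k, n)) : {vspace 'rV[F]_n} :=
  <<[seq row i L | i : 'I_k]>>%VS.

(* Only the values of [p] at the [k]-element sets matter. *)
Definition pluecker_coordinates (W : {vspace 'rV[F]_n}) (p : {set 'I_n} -> F) :
    Prop :=
  exists (L : 'M[F]_(k, n)) (a : F),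
    [/\ \rank L = k, row_span L = W, a != 0
      & forall (I : {set 'I_n}) (hI : #|I| = k), p I = a * minor L hI].

(* A point of the Grassmannian G(k, n) is a subspace [W] with [\dim W = k]. *)
Definition pluecker_of_grassmannian_point (p : {set 'I_n} -> F) : Prop :=
  exists W : {vspace 'rV[F]_n}, \dim W = k /\ pluecker_coordinates W p.

End Pluecker.

(* Main.v *)
Require Import Defs.
From HB Require Import structures.
From mathcomp Require Import all_boot all_order all_algebra.
From mathcomp Require Import all_classical all_reals all_analysis.
From mathcomp Require Import ring lra.

Set Implicit Arguments.
Unset Strict Implicit.
Unset Printing Implicit Defensive.

Import Order.TTheory GRing.Theory Num.Theory.
Import numFieldNormedType.Exports.

Local Open Scope ring_scope.

(** Write p(I) for the number of perfect matchings with boundary set I.  Over a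
    field, a function p on k-element sets that is not identically zero consists
    of the maximal minors of a matrix, up to a common factor, as soon as it
    satisfies the exchange relations
      sum over j in J \ I of (-1)^(rank of j in I + rank of j in J)
                               p(I + j) p(J - j) = 0
    for #|I| = k - 1 and #|J| = k + 1 ([pluecker_relations_realized]): both p
    and the minors satisfy them, they determine p from its values on a set I0
    with p(I0) <> 0 and on the sets that differ from I0 in one element, and a
    matrix with those minors can be written down.

    For matchings the relations hold by superposition.  A term of the sum counts
    pairs (M, M') with boundary sets I + j and J - j.  In the union of M and M'
    every vertex has degree at most two, so the component C of the boundary
    vertex j is a path, and since all boundary vertices are white it has one
    end covered by M alone, namely j, and one covered by M' alone, say j'
    ([superposition_path]).  Exchanging M and M' on C gives a pair with boundary
    sets I + j' and J - j', and exchanging again goes back.  This pairs off the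
    contributions to the terms of j and of j', and they have opposite signs
    ([exchange_sign_flip]): by planarity a component that avoids C cannot join a
    boundary vertex between j and j' to one outside, and each component has as
    many boundary vertices covered by M as by M', so I and J have the same
    number of elements strictly between j and j' ([card_between]).

    Planarity enters only through [noncrossing]: two connected subgraphs
    without a common vertex cannot join two interleaved pairs of boundary
    vertices.  For edges drawn as continuous arcs this is the statement that two
    curves in a disc with interleaved ends on the circle meet ([disc_crossing]).
    It is proved by a parity count.  Were the curves disjoint, sample them by
    points x_i and y_j so finely that on each cell of the grid the four
    differences x_i - y_j lie in a common open half plane, so that the closed
    polygon that they form crosses any given ray from the origin an even number
    of times.  Summing over all cells, the values on the perimeter of the grid
    would cross the ray an even number of times too.  But each side of the grid
    stays in a half plane as well, because its fixed point is on the circle, and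
    there the crossings are counted by the corners: the total is odd. *)

(** * Winding parity on a grid *)

Section Grid.

(** Discrete Stokes formula modulo two: a 0-1 cochain on the edges of a grid that
    has even sum around every cell has even sum around the perimeter. *)
Lemma grid_parity (p q : nat) (h v : nat -> nat -> bool) :
  (forall i j, (i < p)%N -> (j < q)%N ->
     h i j (+) h i j.+1 (+) v i j (+) v i.+1 j = false) ->
  \big[addb/false]_(i < p) h i 0%N (+) \big[addb/false]_(i < p) h i q =
  \big[addb/false]_(j < q) v 0%N j (+) \big[addb/false]_(j < q) v p j.
Proof.
move=> cell.
have row j : (j < q)%N ->
  \big[addb/false]_(i < p) h i j (+) \big[addb/false]_(i < p) h i j.+1 =
  v 0%N j (+) v p j.
  move=> jq; elim: p cell => [|p IHp] cell; first by rewrite !big_ord0 !addbb.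
  have {}IHp := IHp (fun i j ip => cell i j (ltnW ip)).
  rewrite !big_ord_recr /= addbACA IHp.
  move: (cell p j (ltnSn p) jq).
  by move: (h p j) (h p j.+1) (v 0%N j) (v p j) (v p.+1 j) => [] [] [] [] [].
elim: q row {cell} => [|q IHq] row; first by rewrite !big_ord0 !addbb.
have {}IHq := IHq (fun j jq => row j (ltnW jq)).
by rewrite !big_ord_recr /= addbACA -IHq -(row q (ltnSn q)) -addbA addKb.
Qed.

Lemma telescope_parity (p : nat) (s : nat -> bool) (b : bool) :
  \big[addb/false]_(i < p) ((s i (+) s i.+1) && b) = (s 0%N (+) s p) && b.
Proof.
elim: p => [|p IHp]; first by rewrite big_ord0 ?addbb.
rewrite big_ord_recr /= IHp.
by case: b {IHp}; move: (s 0%N) (s p) (s p.+1) => [] [] [].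
Qed.

Variable R : realFieldType.
Implicit Types u v w m : R * R.

Definition dot u w := u.1 * w.1 + u.2 * w.2.
Definition cross u w := u.1 * w.2 - u.2 * w.1.
(** The closed side is counted as one of the two sides, so that a segment meets
    the line spanned by [v] properly exactly when its ends have different
    sides, also if one of them lies on the line. *)
Definition side v u : bool := 0 <= cross v u.

(** The segment from [u] to [w] crosses the open ray spanned by [v].  When the
    ends have different sides, the segment meets the line at the barycentre of
    [u] and [w] with weights [- cross v w] and [cross v u], up to normalization;
    the second condition says that this point is on the positive half of the
    line. *)
Definition crosses v u w : bool :=
  (side v u (+) side v w) &&
  (0 < (cross v u * dot v w - cross v w * dot v u) / (cross v u - cross v w)).

(** The meeting point z of the segment with the line is a multiple of [v] and lies
    in the half plane of [m] by convexity.  Hence it is a positive multiple of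
    [v] exactly when [v] itself is in that half plane; the identity
    (v.v)(m.z) = (v.z)(m.v), true for z parallel to [v], expresses this. *)
Lemma crosses_half_plane v m u w : 0 < dot m u -> 0 < dot m w ->
  crosses v u w = (side v u (+) side v w) && (0 < dot m v).
Proof.
move=> mu mw; rewrite /crosses.
have key : dot v v * (cross v u * dot m w - cross v w * dot m u) =
           (cross v u * dot v w - cross v w * dot v u) * dot m v.
  by rewrite /dot /cross; ring.
move: key; move: (_ - cross v w * dot v u) => z.
have vv : (cross v u != 0) || (cross v w != 0) -> 0 < dot v v.
  apply: contraTT; rewrite -leNgt => vv.
  have [v1 v2] : v.1 = 0 /\ v.2 = 0 by rewrite /dot in vv; split; nra.
  by rewrite /cross v1 v2 !mul0r subrr eqxx.
rewrite /side; case: (leP 0 (cross v u)) => hu; case: (leP 0 (cross v w)) => hw //= key.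
- have {}vv : 0 < dot v v by apply: vv; rewrite (lt_eqF hw) orbT.
  have D : 0 < cross v u - cross v w by lra.
  rewrite pmulr_lgt0 ?invr_gt0 //.
  have zm : 0 < z * dot m v.
    rewrite -key; apply: mulr_gt0 => //; nra.
  by apply/idP/idP => h; [rewrite -(pmulr_rgt0 _ h)|rewrite -(pmulr_lgt0 _ h)].
- have {}vv : 0 < dot v v by apply: vv; rewrite (lt_eqF hu).
  have D : 0 < - (cross v u - cross v w) by lra.
  rewrite -[X in _ / X]opprK invrN mulrN -mulNr pmulr_lgt0 ?invr_gt0 //.
  have zm : 0 < - z * dot m v.
    rewrite mulNr -key -mulrN; apply: mulr_gt0 => //; nra.
  by apply/idP/idP => h; [rewrite -(pmulr_rgt0 _ h)|rewrite -(pmulr_lgt0 _ h)].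
Qed.

(** The ray is spanned by [v], the difference of the two ends of the first curve.
    Of the four sides of the grid only the one where i = 0 crosses it an odd
    number of times: where i = p the half plane does not contain [v], and where
    j = 0 or j = q the two corners differ by a multiple of [v], so they have
    the same side. *)
Lemma discrete_crossing (p q : nat) (x y : nat -> R * R) (mL mR mB mT : R * R) :
  let v := x 0%N - x p in
  (forall i j, (i < p)%N -> (j < q)%N -> exists m,
     [/\ 0 < dot m (x i - y j), 0 < dot m (x i.+1 - y j),
         0 < dot m (x i - y j.+1) & 0 < dot m (x i.+1 - y j.+1)]) ->
  (forall j, (j <= q)%N -> 0 < dot mL (x 0%N - y j)) ->
  (forall j, (j <= q)%N -> 0 < dot mR (x p - y j)) ->
  (forall i, (i <= p)%N -> 0 < dot mB (x i - y 0%N)) ->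
  (forall i, (i <= p)%N -> 0 < dot mT (x i - y q)) ->
  0 < dot mL v -> dot mR v < 0 ->
  side v (x 0%N - y 0%N) (+) side v (x 0%N - y q) -> False.
Proof.
move=> v cell hL hR hB hT mLv mRv opp.
pose h i j := crosses v (x i - y j) (x i.+1 - y j).
pose w i j := crosses v (x i - y j) (x i - y j.+1).
have := @grid_parity p q h w.
have -> : \big[addb/false]_(i < p) h i 0%N = false.
  under eq_bigr => i _ do rewrite /h (crosses_half_plane _ (hB i (ltnW (ltn_ord i))) (hB _ (ltn_ord i))).
  rewrite (telescope_parity p (fun i => side v (x i - y 0%N))).
  suff -> : side v (x p - y 0%N) = side v (x 0%N - y 0%N) by rewrite addbb.
  by rewrite /side /v /cross /=; congr (0 <= _); ring.
have -> : \big[addb/false]_(i < p) h i q = false.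
  under eq_bigr => i _ do rewrite /h (crosses_half_plane _ (hT i (ltnW (ltn_ord i))) (hT _ (ltn_ord i))).
  rewrite (telescope_parity p (fun i => side v (x i - y q))).
  suff -> : side v (x p - y q) = side v (x 0%N - y q) by rewrite addbb.
  by rewrite /side /v /cross /=; congr (0 <= _); ring.
have -> : \big[addb/false]_(j < q) w 0%N j = true.
  under eq_bigr => j _ do rewrite /w (crosses_half_plane _ (hL j (ltnW (ltn_ord j))) (hL _ (ltn_ord j))).
  by rewrite (telescope_parity q (fun j => side v (x 0%N - y j))) mLv opp.
have -> : \big[addb/false]_(j < q) w p j = false.
  under eq_bigr => j _ do rewrite /w (crosses_half_plane _ (hR j (ltnW (ltn_ord j))) (hR _ (ltn_ord j))).
  by rewrite (telescope_parity q (fun j => side v (x p - y j))) (lt_gtF mRv) andbF.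
move=> parity; suff : false (+) false = true (+) false by [].
apply: parity => i j ip jq.
have [m [m00 m10 m01 m11]] := cell i j ip jq.
rewrite /h /w (crosses_half_plane v m00 m10) (crosses_half_plane v m01 m11).
rewrite (crosses_half_plane v m00 m01) (crosses_half_plane v m10 m11).
by case: (0 < _); rewrite ?andbF //; do 4 case: (side _ _).
Qed.

End Grid.

(** * Chains of small steps *)

Section Chain.
Local Open Scope classical_set_scope.
Variables (R : realType) (T : pseudoMetricType R).
Implicit Types (K : set T) (e : R) (a b c : T).

(** Chains replace curves: they can be concatenated without reparametrization,
    and every connected set provides them for every step length [e]. *)
Inductive chain K e a : T -> Prop :=
| Chain0 : K a -> chain K e a a
| ChainS b c : chain K e a b -> K c -> ball b e c -> chain K e a c.

Lemma chain_in K e a b : chain K e a b -> K b.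
Proof. by case. Qed.

Lemma chain_trans K e a b c : chain K e a b -> chain K e b c -> chain K e a c.
Proof. by move=> ab; elim=> // c' d _ ac' Kd c'd; exact: ChainS Kd c'd. Qed.

Lemma chainW K K' e a b : K `<=` K' -> chain K e a b -> chain K' e a b.
Proof.
move=> KK'; elim=> [Ka|b' c _ ab' Kc b'c]; first exact/Chain0/KK'.
by apply: ChainS ab' _ b'c; exact: KK'.
Qed.

Lemma chain_seq K e a b : chain K e a b -> exists (p : nat) (x : nat -> T),
  [/\ x 0%N = a, x p = b, forall i, (i <= p)%N -> K (x i)
    & forall i, (i < p)%N -> ball (x i) e (x i.+1)].
Proof.
elim=> [Ka|b' c _ [p [x [x0 xp Kx step]]] Kc b'c].
  by exists 0%N, (fun=> a); split.
exists p.+1, (fun i => if (i <= p)%N then x i else c); split => //=.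
- by rewrite ltnn.
- by move=> i _; case: ifP => // ip; exact: Kx.
move=> i; rewrite ltnS => ip; rewrite ip; case: ifP => ip1; first exact: step.
by have -> : i = p; [apply/eqP; rewrite eqn_leq ip leqNgt ip1|rewrite xp].
Qed.

(** The points of [K] that a chain from [a] reaches form an open and closed
    subset of [K], since within distance [e] reachability does not change. *)
Lemma connected_chain K e a b : connected K -> 0 < e -> K a -> K b ->
  chain K e a b.
Proof.
move=> Kconn e0 Ka; suff aK : chain K e a = K by rewrite -{1}aK.
apply: Kconn; first by exists a; exact: Chain0.
- exists (\bigcup_(z in chain K e a) (ball z e)^°).
    by apply: bigcup_open => z _; exact: open_interior.
  apply/seteqP; split => [z az|z [Kz [y ay /interior_subset yz]]].
    split; first exact: chain_in az.
    exists z => //; apply: nbhs_singleton; apply: nbhs_interior.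
    exact: nbhsx_ballx.
  exact: ChainS Kz yz.
exists (~` \bigcup_(z in K `\` chain K e a) (ball z e)^°).
  by apply/open_closedC/bigcup_open => z _; exact: open_interior.
apply/seteqP; split => [z az|z [Kz nz]].
  split; first exact: chain_in az.
  move=> [y [Ky nay] /interior_subset/ball_sym zy]; apply: nay.
  exact: ChainS Ky zy.
apply: contrapT => naz; apply: nz; exists z => //.
by apply: nbhs_singleton; apply: nbhs_interior; exact: nbhsx_ballx.
Qed.

Lemma compact_disjoint_dist K K' : compact K -> closed K' ->
  K `&` K' = set0 ->
  exists2 e, 0 < e & forall a b, K a -> K' b -> ~ ball a e b.
Proof.
move=> /compact_near_coveringP Kc K'c KK'.
have : \forall e \near (0:R)^'+, K `<=` (fun a => forall b, K' b -> ~ ball a e b).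
  apply: Kc => a Ka.
  have : nbhs a (~` K').
    apply: open_nbhs_nbhs; split; first exact: closed_openC.
    by move=> K'a; have : (K `&` K') a by []; rewrite KK'.
  move=> /nbhs_ballP[e /= e0 ae].
  have e2 : 0 < e / 2 by exact: divr_gt0.
  near=> a' e'.
  have e'e : e' <= e / 2 by near: e'; exact: nbhs_right_le.
  have aa' : ball a (e / 2) a' by near: a'; exact: nbhsx_ballx.
  move=> b K'b a'b; apply: (ae b) => //.
  by rewrite [e]splitr; apply: (ball_triangle aa'); exact: le_ball a'b.
move=> /(filterI (nbhs_right_gt (0 : R)))/filter_ex[e [e0 He]].
by exists e => // a b Ka; exact: He.
Unshelve. all: by end_near. Qed.

End Chain.

(** * Crossing curves in a disc *)

Section Disc.
Local Open Scope classical_set_scope.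
Variable R : realType.
Implicit Types (c g y : R * R) (r t : R).

Definition circle_point c r t : R * R := (c.1 + r * cos t, c.2 + r * sin t).

(** A disc is strictly convex: seen from a point [g] of its circle, every other
    point of the disc is strictly on the inner side of the tangent line. *)
Lemma in_disc_outward c r g y :
  (g.1 - c.1) ^+ 2 + (g.2 - c.2) ^+ 2 = r ^+ 2 ->
  (y.1 - c.1) ^+ 2 + (y.2 - c.2) ^+ 2 <= r ^+ 2 -> g <> y ->
  0 < dot (g - c) (g - y).
Proof.
move: g y c => [g1 g2] [y1 y2] [c1 c2] /= gr yr gy; rewrite /dot /=.
have : 0 < (g1 - y1) ^+ 2 + (g2 - y2) ^+ 2; last by nra.
rewrite lt_neqAle addr_ge0 ?sqr_ge0 // andbT eq_sym.
rewrite paddr_eq0 ?sqr_ge0 // !sqrf_eq0 !subr_eq0.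
by apply/negP => /andP[/eqP ? /eqP ?]; apply: gy; congr pair.
Qed.

(** A vector of sup norm at least [e] keeps a positive inner product with any
    perturbation of itself by less than 2e/5 in each coordinate: a coordinate
    of size at least [e] contributes at least 3/5 e^2, the other one at least
    - 1/25 e^2. *)
Lemma far_dot_gt0 (e u1 u2 d1 d2 : R) : 0 < e ->
  ~ (`|u1| < e /\ `|u2| < e) -> `|d1| < 2 * (e / 5) -> `|d2| < 2 * (e / 5) ->
  0 < u1 * (u1 + d1) + u2 * (u2 + d2).
Proof.
move=> e0 far d1e d2e.
have large u d : `|d| < 2 * (e / 5) -> e <= `|u| -> e * (3 * (e / 5)) <= u * (u + d).
  rewrite ltr_norml ler_normr => /andP[dl dr] /orP[ue|ue]; first by apply: ler_pM; lra.
  by rewrite -[u * _]mulrNN; apply: ler_pM; lra.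
have small u d : `|d| < 2 * (e / 5) -> - (e / 5) ^+ 2 <= u * (u + d).
  move: (e / 5) => q; rewrite ltr_norml => /andP[dl dr].
  have dq : 0 <= (2 * q - d) * (2 * q + d) by apply: mulr_ge0; lra.
  have -> : u * (u + d) = (u + d / 2) ^+ 2 - (d / 2) ^+ 2 by field.
  have := sqr_ge0 (u + d / 2); nra.
have e2 : 0 < e ^+ 2 by exact: exprn_gt0.
have [u1e|u1e] := leP e `|u1|.
  by have := large _ _ d1e u1e; have := small u2 _ d2e; lra.
have [u2e|u2e] := leP e `|u2|; last by case: far.
by have := large _ _ d2e u2e; have := small u1 _ d1e; lra.
Qed.

Lemma circle_point_on c r t :
  ((circle_point c r t).1 - c.1) ^+ 2 + ((circle_point c r t).2 - c.2) ^+ 2 =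
  r ^+ 2.
Proof.
rewrite /= ![_ + _ - _]addrAC !subrr !add0r !exprMn -mulrDr cos2Dsin2.
by rewrite mulr1.
Qed.

(** Three points met in this order counterclockwise form a positively oriented
    triangle, of area 2 r^2 sin x sin y sin (x + y) with [x] and [y] half
    the angles between consecutive points. *)
Lemma circle_orientation c r t0 t1 t2 :
  0 < r -> t0 < t1 -> t1 < t2 -> t2 < t0 + 2 * pi ->
  0 < cross (circle_point c r t1 - circle_point c r t0)
            (circle_point c r t2 - circle_point c r t0).
Proof.
move=> r0 t01 t12 t20.
pose x := (t1 - t0) / 2; pose y := (t2 - t1) / 2.
have -> : t2 = t0 + ((x + x) + (y + y)) by rewrite /x /y; lra.
have -> : t1 = t0 + (x + x) by rewrite /x; lra.
have sx : 0 < sin x by apply: sin_gt0_pi; rewrite /x; lra.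
have sy : 0 < sin y by apply: sin_gt0_pi; rewrite /y; lra.
have sxy : 0 < sin (x + y) by apply: sin_gt0_pi; rewrite /x /y; lra.
suff -> : cross (circle_point c r (t0 + (x + x)) - circle_point c r t0)
    (circle_point c r (t0 + (x + x + (y + y))) - circle_point c r t0) =
    r ^+ 2 * (4 * sin x * sin y * sin (x + y)).
  by rewrite !mulr_gt0 // exprn_gt0.
rewrite /cross /circle_point /= !(sinD, cosD).
have := cos2Dsin2 t0; have := cos2Dsin2 x; have := cos2Dsin2 y.
move: (cos t0) (sin t0) (cos x) (sin x) (cos y) (sin y) => C S a s b t.
move=> Hy Hx H0.
have Hb : b ^+ 2 = 1 - t ^+ 2 by rewrite -Hy; ring.
have Ha : a ^+ 2 = 1 - s ^+ 2 by rewrite -Hx; ring.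
have HC : C ^+ 2 = 1 - S ^+ 2 by rewrite -H0; ring.
by ring: Hb Ha HC.
Qed.

(** If the sets were disjoint, their distance would be some [e] > 0.  Steps of
    length e/5 in both chains move a difference x_i - y_j by less than 2e/5
    within a cell, so [far_dot_gt0] provides the half plane of the cell.  The
    half planes of the four sides of the grid come from the tangents at the
    four given points of the circle. *)
Lemma disc_crossing c r (K K' : set (R * R)) (t0 t1 t2 t3 : R) :
  let P := circle_point c r in
  0 < r -> t0 < t1 -> t1 < t2 -> t2 < t3 -> t3 < t0 + 2 * pi ->
  compact K -> compact K' ->
  (forall z, (K `|` K') z ->
     (z.1 - c.1) ^+ 2 + (z.2 - c.2) ^+ 2 <= r ^+ 2) ->
  (forall e, 0 < e -> chain K e (P t0) (P t2)) ->
  (forall e, 0 < e -> chain K' e (P t1) (P t3)) ->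
  K `&` K' <> set0.
Proof.
move=> P r0 t01 t12 t23 t30 Kc K'c disc chK chK' KK'.
have [e e0 dist] : exists2 e, 0 < e & forall a b, K a -> K' b -> ~ ball a e b.
  apply: compact_disjoint_dist => //; apply: compact_closed K'c.
  exact: norm_hausdorff.
have e5 : 0 < e / 5 by exact: divr_gt0.
have [p [x [x0 xp Kx xstep]]] := chain_seq (chK _ e5).
have [q [y [y0 yq K'y ystep]]] := chain_seq (chK' _ e5).
have neq i j : (i <= p)%N -> (j <= q)%N -> x i <> y j.
  move=> ip jq xy; apply: (dist _ _ (Kx i ip) (K'y j jq)).
  by rewrite xy; exact: ballxx.
have discK i : (i <= p)%N -> _ := fun ip => disc _ (or_introl (Kx i ip)).
have discK' j : (j <= q)%N -> _ := fun jq => disc _ (or_intror (K'y j jq)).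
have o012 := @circle_orientation c r _ _ _ r0 t01 t12 ltac:(lra).
have o023 := @circle_orientation c r _ _ _ r0 (lt_trans t01 t12) t23 t30.
have P02 : P t0 <> P t2.
  by move=> P02; move: o023; rewrite -/P P02 /cross /= !subrr !mul0r subrr ltxx.
apply: (@discrete_crossing _ p q x y (P t0 - c) (P t2 - c) (c - P t1) (c - P t3)).
- move=> i j ip jq; exists (x i - y j).
  have far : ~ (`|(x i - y j).1| < e /\ `|(x i - y j).2| < e).
    by move=> xy; apply: (dist _ _ (Kx i (ltnW ip)) (K'y j (ltnW jq))).
  have := xstep i ip; have := ystep j jq.
  rewrite /ball /= /prod_ball /= -!ball_normE /= => -[y1 y2] [x1 x2].
  have add5 (d d' : R) : `|d| < e / 5 -> `|d'| < e / 5 -> `|d' - d| < 2 * (e / 5).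
    by move=> dl dl'; rewrite mulr_natl mulr2n (le_lt_trans (ler_normB _ _)) ?ltrD.
  have shift d d' : `|(x i).1 - d.1| < e / 5 -> `|(x i).2 - d.2| < e / 5 ->
      `|(y j).1 - d'.1| < e / 5 -> `|(y j).2 - d'.2| < e / 5 ->
      0 < dot (x i - y j) (d - d').
    move=> h1 h2 h3 h4.
    have := far_dot_gt0 e0 far (add5 _ _ h1 h3) (add5 _ _ h2 h4).
    by congr (0 < _); rewrite /dot /=; ring.
  by split; apply: shift; rewrite ?subrr ?normr0.
- move=> j jq; rewrite x0; apply: (in_disc_outward (circle_point_on _ _ _)).
    exact: discK'.
  by rewrite -/(P t0) -x0; exact: neq.
- move=> j jq; rewrite xp; apply: (in_disc_outward (circle_point_on _ _ _)).
    exact: discK'.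
  by rewrite -/(P t2) -xp; exact: neq.
- move=> i ip; have -> : dot (c - P t1) (x i - y 0%N) = dot (P t1 - c) (P t1 - x i).
    by rewrite y0 /dot /=; ring.
  apply: (in_disc_outward (circle_point_on _ _ _)); first exact: discK.
  by rewrite -/(P t1) -y0; apply/nesym/neq.
- move=> i ip; have -> : dot (c - P t3) (x i - y q) = dot (P t3 - c) (P t3 - x i).
    by rewrite yq /dot /=; ring.
  apply: (in_disc_outward (circle_point_on _ _ _)); first exact: discK.
  by rewrite -/(P t3) -yq; apply/nesym/neq.
- rewrite x0 xp; apply: (in_disc_outward (circle_point_on _ _ _)).
    by rewrite -xp; exact: discK.
  by [].
- rewrite x0 xp -oppr_gt0.
  have -> : - dot (P t2 - c) (P t0 - P t2) = dot (P t2 - c) (P t2 - P t0).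
    by rewrite /dot /=; ring.
  apply: (in_disc_outward (circle_point_on _ _ _)).
    by rewrite -x0; exact: discK.
  exact: nesym.
(* The points at t1 and t3 are on different sides of the chord from t0 to t2. *)
rewrite x0 xp y0 yq /side.
have -> : cross (P t0 - P t2) (P t0 - P t1) = - cross (P t1 - P t0) (P t2 - P t0).
  by rewrite /cross /=; ring.
have -> : cross (P t0 - P t2) (P t0 - P t3) = cross (P t2 - P t0) (P t3 - P t0).
  by rewrite /cross /=; ring.
by rewrite oppr_ge0 leNgt o012 (ltW o023).
Qed.

End Disc.

(** * Noncrossing connections in an embedded graph *)

Section Edges.
Variables (n : nat) (G : bgraph n).
Implicit Types (x y : G) (e : {set G}) (j : 'I_n).

Lemma bdry_boundary j : bdry G j \in boundary G.
Proof. by apply: imset_f; rewrite finset.in_setT. Qed.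

Lemma edgesP e :
  reflect (exists x y, adj x y /\ e = [set x; y]) (e \in edges G).
Proof.
rewrite inE; apply: (iffP existsP) => [[x /existsP[y /andP[xy /eqP ->]]]|[x [y [xy ->]]]].
  by exists x, y.
by exists x; apply/existsP; exists y; rewrite xy /=.
Qed.

Lemma adj_neq x y : adj x y -> x != y.
Proof. by apply: contraTneq => ->; rewrite adj_irr. Qed.

Lemma edge_adj x y : [set x; y] \in edges G -> adj x y.
Proof.
case/edgesP => u [w [uw /setP E]]; have := adj_neq uw; have := adj_sym u w.
move: (E x) (E y) (E u) (E w); rewrite !inE !eqxx !orbT /=.
move=> /esym/orP[]/eqP-> /esym/orP[]/eqP->; rewrite ?eqxx ?orbb //=.
- by move=> _ /eqP->; rewrite eqxx.
- by move=> _ _ <-.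
- by move=> /eqP->; rewrite eqxx.
Qed.

End Edges.

Section Noncrossing.
Local Open Scope classical_set_scope.
Variables (R : realType) (n : nat) (G : bgraph n).
Variables (pos : G -> R * R) (arc : {set G} -> R -> R * R).

(** Only the edges with both ends in [C] are drawn; so for disjoint vertex sets
    the drawings share no point of an edge. *)
Definition drawing (C : {set G}) : set (R * R) :=
  (\bigcup_(v in [set` enum C]) [set pos v]) `|`
  (\bigcup_(e in [set` enum [set e in edges G | e \subset C]%SET])
    (arc e @` `[0, 1])).

Variables (c : R * R) (r : R).
Hypothesis emb : is_disc_embedding c r pos arc.

Lemma drawing_compact C : compact (drawing C).
Proof.
apply: compactU; rewrite bigcup_seq.
  by apply: bigsetU_compact => v _; exact: compact_set1.
rewrite big_enum_cond /=; apply: bigsetU_compact => e.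
move=> /andP[/setIdP[eG _] _].
apply: continuous_compact; last exact: segment_compact.
exact: (emb_arc_cont emb).
Qed.

(** Splits the arcs into vertices and open arcs, the form in which the embedding
    axioms exclude coincidences. *)
Lemma drawingP C z : drawing C z ->
  (exists2 v, v \in C & z = pos v) \/
  (exists e t, [/\ e \in edges G, e \subset C, t \in `]0, 1[%R & z = arc e t]).
Proof.
case=> [[v /=]|[e /=]]; rewrite mem_enum; first by left; exists v.
move=> /setIdP[eG eC] [t /= t01 <-].
have [x [y [exy a0 a1]]] := emb_arc_ends emb eG.
move: t01; rewrite in_itv /= !le_eqVlt => /andP[/orP[/eqP <-|t0]].
  move=> _; left; exists x; rewrite // (fintype.subsetP eC) // exy !inE eqxx //.
move=> /orP[/eqP ->|t1].
  left; exists y; rewrite // (fintype.subsetP eC) // exy !inE eqxx ?orbT //.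
by right; exists e, t; split=> //; rewrite in_itv /= t0 t1.
Qed.

Lemma drawing_in_disc C z : drawing C z ->
  (z.1 - c.1) ^+ 2 + (z.2 - c.2) ^+ 2 <= r ^+ 2.
Proof.
move=> /drawingP[[v _ ->]|[e [t [eG _ t01 ->]]]]; first exact: emb_pos_disc emb _.
apply: (emb_arc_disc emb) => //; move: t01; rewrite !in_itv /=.
by move=> /andP[/ltW-> /ltW->].
Qed.

Lemma drawing_disjoint (C C' : {set G}) : [disjoint C & C']%B ->
  drawing C `&` drawing C' = set0.
Proof.
move=> CC'; apply/seteqP; split=> // z [].
have {}CC' v : v \in C -> v \in C' -> False.
  by move=> vC vC'; rewrite (disjointFr CC' vC) in vC'.
move=> /drawingP[[v vC zv]|[e [t [eG eC t01 zt]]]] /drawingP[[w wC' zw]|[f [s [fG fC' s01 zs]]]].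
- apply: (CC' v) => //; suff -> : v = w by [].
  by apply: (emb_pos_inj emb); rewrite -zv.
- by apply: (emb_arc_vertex emb fG s01 (v := v)); rewrite -zs.
- by apply: (emb_arc_vertex emb eG t01 (v := w)); rewrite -zt.
have [ef|ef] := eqVneq e f; last first.
  by apply: (emb_arc_disjoint emb eG fG ef t01 s01); rewrite -zt -zs.
have /edgesP[x [y [_ exy]]] := eG.
have xe : x \in e by rewrite exy !inE eqxx.
apply: (CC' x); first exact: (fintype.subsetP eC).
by apply: (fintype.subsetP fC'); rewrite -ef.
Qed.

Lemma drawing_chain (C : {set G}) (h : rel G) (e : R) x y :
  subrel h (@adj n G) -> 0 < e ->
  (forall z, connect h x z -> z \in C) ->
  connect h x y -> chain (drawing C) e (pos x) (pos y).
Proof.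
move=> hadj e0 hC /connectP[p hp ->].
have vC v : v \in C -> drawing C (pos v).
  by move=> vC; left; exists v => //=; rewrite mem_enum.
elim: p x hC hp => [|z p IHp] x hC /=.
  by move=> _; apply: Chain0; apply: vC; exact: hC.
move=> /andP[xz zp]; apply: (@chain_trans _ _ _ _ _ (pos z)); last first.
  by apply: IHp => // w zw; apply: hC; apply: connect_trans zw; exact: connect1.
pose f : {set G} := [set x; z]%SET.
have fG : f \in edges G by apply/edgesP; exists x, z; split=> //; exact: hadj.
have fC : f \subset C.
  by apply/fintype.subsetP => w; rewrite !inE => /orP[]/eqP->; apply: hC => //; exact: connect1.
apply: (@chainW _ _ (arc f @` `[0, 1])) => [w fw|].
  by right; exists f => //=; rewrite mem_enum inE fG.
have [u [v [fuv a0 a1]]] := emb_arc_ends emb fG.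
have ends w : w \in f -> (arc f @` `[0, 1]) (pos w).
  move=> wf; have : w \in [set u; v]%SET by rewrite -fuv.
  rewrite !inE => /orP[]/eqP->.
    by exists 0; rewrite /= ?in_itv /= ?lexx ?ler01.
  by exists 1; rewrite /= ?in_itv /= ?lexx ?ler01.
apply: connected_chain => //; last 2 first.
- by apply: ends; rewrite !inE eqxx.
- by apply: ends; rewrite !inE eqxx orbT.
apply: connected_continuous_connected; first exact: segment_connected.
exact: (emb_arc_cont emb).
Qed.

End Noncrossing.

(** Otherwise the components of [i0] and [i1] are disjoint, and so are their
    drawings, although these contain chains between interleaved points of the
    circle. *)
Lemma noncrossing (R : realType) (n : nat) (G : bgraph n) (h : rel G)
    (i0 i1 i2 i3 : 'I_n) :
  embedded_in_disc R G -> subrel h (@adj n G) -> symmetric h ->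
  (i0 < i1)%N -> (i1 < i2)%N -> (i2 < i3)%N ->
  connect h (bdry G i0) (bdry G i2) -> connect h (bdry G i1) (bdry G i3) ->
  connect h (bdry G i0) (bdry G i1).
Proof.
move=> [c [r [pos [arc emb]]]] hadj /sym_connect_sym hsym i01 i12 i23 c02 c13.
apply/negPn/negP => nc01.
have [theta [inc period tpos]] := emb_bdry emb.
pose C j : {set G} := [set v | connect h (bdry G j) v].
have disj : [disjoint C i0 & C i1].
  rewrite -setI_eq0; apply/eqP/setP => v; rewrite !inE; apply/andP => -[c0v c1v].
  by move/negP: nc01; apply; apply: (connect_trans c0v); rewrite hsym.
apply: (@disc_crossing R c r (drawing pos arc (C i0)) (drawing pos arc (C i1))
  _ _ _ _ (emb_radius emb) (inc _ _ i01) (inc _ _ i12) (inc _ _ i23)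
  (period _ _)); first exact: drawing_compact emb _.
- exact: drawing_compact emb _.
- by move=> z []; exact: drawing_in_disc.
- move=> e e0; rewrite /circle_point -!tpos; apply: (drawing_chain emb hadj) => //.
  by move=> z; rewrite inE.
- move=> e e0; rewrite /circle_point -!tpos; apply: (drawing_chain emb hadj) => //.
  by move=> z; rewrite inE.
exact: (drawing_disjoint emb disj).
Qed.

(** * Increasing enumeration of a set of columns *)

Section IncreasingEnumeration.
Variable n : nat.
Implicit Types (A B I J : {set 'I_n}) (j : 'I_n).

Definition rank_in A j : nat := #|[set x in A | (x < j)%N]|.

Definition colenum k A (hA : #|A| = k) (i : 'I_k) : 'I_n :=
  enum_val (cast_ord (esym hA) i).

Lemma eq_colenum k A B (hA : #|A| = k) (hB : #|B| = k) :
  A = B -> colenum hA =1 colenum hB.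
Proof. by move=> AB; subst B; rewrite (eq_irrelevance hA hB). Qed.

Lemma colenum_in k A (hA : #|A| = k) i : colenum hA i \in A.
Proof. exact: enum_valP. Qed.

Lemma colenum_inj k A (hA : #|A| = k) : injective (colenum hA).
Proof. by move=> i i' /enum_val_inj/cast_ord_inj. Qed.

Lemma colenum_onto k A (hA : #|A| = k) j : j \in A -> exists i, j = colenum hA i.
Proof.
move=> jA; exists (cast_ord hA (enum_rank_in jA j)).
by rewrite /colenum cast_ordK enum_rankK_in.
Qed.

Lemma colenum_lt k A (hA : #|A| = k) (i i' : 'I_k) :
  (colenum hA i < colenum hA i')%N = (i < i')%N.
Proof.
have mono (u v : 'I_k) : (u < v)%N -> (colenum hA u < colenum hA v)%N.
  move=> uv; rewrite /colenum /enum_val.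
  have sz (w : 'I_k) : (w < size (enum A))%N by rewrite -cardE hA.
  set x0 := enum_default _; rewrite (set_nth_default x0 (enum_default _)); last exact: sz.
  have tr : transitive (relpre (@nat_of_ord n) ltn) by move=> y x z; apply: ltn_trans.
  have srt : sorted (relpre val ltn) (enum A).
    rewrite /enum_mem; apply: sorted_filter => //.
    by rewrite -enumT -sorted_map val_enum_ord iota_ltn_sorted.
  by apply: (sorted_ltn_nth tr x0 srt) => //; exact: sz.
have [ii'|i'i|/val_inj->] := ltngtP i i'; last by rewrite ltnn.
  exact: mono.
by apply/negbTE; rewrite -leqNgt ltnW // mono.
Qed.

Lemma rank_colenum k A (hA : #|A| = k) (i : 'I_k) : rank_in A (colenum hA i) = i.
Proof.
rewrite /rank_in.
have -> : [set x in A | (x < colenum hA i)%N] =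
          [set colenum hA i' | i' in [set i' : 'I_k | (i' < i)%N]].
  apply/setP => x; rewrite inE; apply/andP/imsetP.
    move=> [/(colenum_onto hA)[i' ->]]; rewrite colenum_lt => ii'.
    by exists i'; rewrite ?inE.
  by move=> [i']; rewrite inE => ii' ->; rewrite colenum_in colenum_lt.
rewrite card_imset; last exact: colenum_inj.
rewrite -sum1dep_card -(big_ord_widen k (fun=> 1%N) (ltnW (ltn_ord i))).
by rewrite sum1_card card_ord.
Qed.

Lemma rank_in_inj A : {in A &, injective (rank_in A)}.
Proof.
move=> x y /(colenum_onto (erefl _))[i ->] /(colenum_onto (erefl _))[i' ->].
by rewrite !rank_colenum => /val_inj->.
Qed.

Lemma rank_in_le A j : (rank_in A j <= #|A|)%N.
Proof. by apply: subset_leq_card; apply/fintype.subsetP => x; rewrite inE => /andP[]. Qed.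

Lemma rank_inU1 A j x : j \notin A ->
  rank_in (j |: A) x = ((j < x)%N + rank_in A x)%N.
Proof.
move=> jA; rewrite /rank_in; case: (boolP (j < x)%N) => jx.
  have -> : [set y in j |: A | (y < x)%N] = j |: [set y in A | (y < x)%N].
    by apply/setP => y; rewrite !inE; case: eqP => [->|].
  by rewrite cardsU1 inE (negbTE jA).
rewrite add0n; apply: eq_card => y; rewrite !inE.
by case: eqP => [->|//]; rewrite (negbTE jx) !andbF.
Qed.

Lemma rank_in_le_lt A j x : j \notin A -> x \in A ->
  (rank_in A j <= rank_in A x)%N = (j < x)%N.
Proof.
move=> jA xA; have [jx|xj|/val_inj xj] := ltngtP j x; last by rewrite xj xA in jA.
  apply: subset_leq_card; apply/fintype.subsetP => y; rewrite !inE => /andP[-> yj].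
  exact: ltn_trans jx.
apply/negbTE; rewrite -ltnNge; apply: proper_card; apply/properP; split.
  apply/fintype.subsetP => y; rewrite !inE => /andP[-> yx]; exact: ltn_trans xj.
by exists x; rewrite !inE ?ltnn ?andbF // xA.
Qed.

Lemma rank_in_between A j j' : (j < j')%N ->
  rank_in A j' = (rank_in A j + (j \in A) + #|[set x : 'I_n in A | (j < x < j')%N]|)%N.
Proof.
move=> jj'; rewrite /rank_in -addnA.
rewrite -(cardsID [set x : 'I_n | (x < j)%N] [set x : 'I_n in A | (x < j')%N]); congr (_ + _)%N.
  apply: eq_card => x; rewrite !inE; case: (ltnP x j) => xj; rewrite ?andbF ?andbT //.
  by rewrite (ltn_trans xj jj') andbT.
rewrite (cardsD1 j) !inE ltnn jj' !andbT /=; congr (_ + _)%N.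
apply: eq_card => x; rewrite !inE -leqNgt [(j <= x)%N]leq_eqVlt.
rewrite -[_ == _ :> nat]/(j == x) [x == j]eq_sym; case: (eqVneq j x) => [<-|_] /=.
  by rewrite ltnn !andbF.
by rewrite andbCA.
Qed.

Definition insert_col k (f : 'I_k -> 'I_n) (i0 : 'I_k.+1) j (i : 'I_k.+1) : 'I_n :=
  if unlift i0 i is Some i' then f i' else j.

(** Adding [j] to a set inserts it in the enumeration at the position given by its
    rank and shifts the later columns: the source of all signs below.  It is
    enough to compare ranks, which separate the elements of a set. *)
Lemma colenumU1 k A (hA : #|A| = k) j (hjA : #|j |: A| = k.+1) (i0 : 'I_k.+1) :
  j \notin A -> i0 = rank_in A j :> nat ->
  colenum hjA =1 insert_col (colenum hA) i0 j.
Proof.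
move=> jA i0j i; apply: (@rank_in_inj (j |: A)); first exact: colenum_in.
  rewrite /insert_col; case: unliftP => [i' _|_]; rewrite !inE ?eqxx //.
  by rewrite colenum_in orbT.
rewrite rank_colenum rank_inU1 // /insert_col.
case: unliftP => [i' ->|->]; last by rewrite ltnn -i0j.
by rewrite /= /bump i0j -[X in (_ <= X)%N](rank_colenum hA) rank_in_le_lt ?colenum_in // rank_colenum.
Qed.

End IncreasingEnumeration.

(** * Exchange relations for minors *)

Section Minors.
Variables (F : fieldType) (n : nat).
Implicit Types (I J : {set 'I_n}) (j : 'I_n) (p q : {set 'I_n} -> F).

Definition pluecker_relations k p : Prop :=
  forall I J, #|I|.+1 = k -> #|J| = k.+1 ->
  \sum_(j in J :\: I)
    (-1) ^+ (rank_in I j + rank_in J j) * p (j |: I) * p (J :\ j) = 0.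

(** Extends the minors by zero to all sets of columns, so that they can be compared
    with other functions of sets without carrying cardinality proofs. *)
Definition total_minor k (L : 'M[F]_(k, n)) (I : {set 'I_n}) : F :=
  if @eqP _ #|I| k is ReflectT hI then minor L hI else 0.

Lemma minorE k (L : 'M[F]_(k, n)) I (hI : #|I| = k) : total_minor L I = minor L hI.
Proof.
by rewrite /total_minor; case: eqP => [hI'|//]; rewrite (eq_irrelevance hI' hI).
Qed.

Lemma minor_colenum k (L : 'M[F]_(k, n)) I (hI : #|I| = k) (f : 'I_k -> 'I_n) :
  f =1 colenum hI -> total_minor L I = \det (colsub f L).
Proof.
by move=> fE; rewrite minorE /minor; congr (\det _); apply/matrixP => r i; rewrite !mxE fE.
Qed.

Lemma insert_colK k (f : 'I_k -> 'I_n) (i0 : 'I_k.+1) j :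
  insert_col f i0 j \o lift i0 =1 f.
Proof. by move=> i; rewrite /insert_col /= liftK. Qed.

(** The coefficients [cof] are the cofactors of the column [j]; they do not depend
    on it.  The linear form that they define vanishes on a column of [I] since
    it then computes a determinant with a repeated column. *)
Lemma minor_linear k (L : 'M[F]_(k, n)) I : #|I|.+1 = k ->
  exists cof : 'I_k -> F,
    (forall j, j \notin I -> total_minor L (j |: I) =
        (-1) ^+ rank_in I j * \sum_r L r j * cof r) /\
    (forall j, j \in I -> \sum_r L r j * cof r = 0).
Proof.
case: k L => // k L [hI].
exists (fun r : 'I_k.+1 => (-1) ^+ r * \det (row' r (colsub (colenum hI) L))).
have det_insert (i0 : 'I_k.+1) j : \det (colsub (insert_col (colenum hI) i0 j) L) =
    (-1) ^+ i0 * \sum_r L r j * ((-1) ^+ r * \det (row' r (colsub (colenum hI) L))).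
  rewrite (expand_det_col _ i0) mulr_sumr; apply: eq_bigr => r _.
  rewrite !mxE /insert_col unlift_none /cofactor exprD.
  suff -> : row' r (col' i0 (colsub (insert_col (colenum hI) i0 j) L)) =
            row' r (colsub (colenum hI) L) by ring.
  by apply/matrixP => a b; rewrite !mxE; congr (L _ _); exact: insert_colK.
split=> j jI.
  have hjI : #|j |: I| = k.+1 by rewrite cardsU1 jI hI.
  have i0P : (rank_in I j < k.+1)%N by rewrite ltnS -hI rank_in_le.
  rewrite (minor_colenum L (hI := hjI) (f := insert_col (colenum hI) (Ordinal i0P) j)).
    exact: det_insert.
  by move=> i; rewrite (colenumU1 hI hjI (i0 := Ordinal i0P)).
have [i ji] := colenum_onto hI jI.
have := det_insert ord0 j; rewrite expr0 mul1r => <-.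
rewrite -det_tr; apply: (@determinant_alternate _ _ _ ord0 (lift ord0 i)) => // a.
by rewrite !mxE /insert_col unlift_none liftK ji.
Qed.

(** By [minor_linear] the sum is a combination, over the rows [r], of the sums
    of (-1)^(rank of j) L_rj det L_(J - j).  Each of these expands along its
    first row the determinant of the columns [J] of [L] with the row [r]
    repeated on top, so it is zero. *)
Lemma minor_pluecker k (L : 'M[F]_(k, n)) : pluecker_relations k (total_minor L).
Proof.
move=> I J hI hJ; have [cof [cofN cof0]] := minor_linear L hI.
transitivity (\sum_(j in J) (-1) ^+ rank_in J j * (\sum_r L r j * cof r) * total_minor L (J :\ j)).
  (* The form vanishes on the columns of I, so the sum extends to all of J. *)
  rewrite [RHS](big_setID I) /= [X in _ = X + _]big1 ?add0r; last first.
    by move=> j /setIP[_ jI]; rewrite (cof0 _ jI) mulr0 mul0r.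
  apply: eq_bigr => j /setDP[_ jI]; rewrite cofN // exprD.
  by rewrite mulrCA !mulrA -expr2 sqrr_sign mul1r.
under eq_bigr do rewrite mulr_sumr mulr_suml.
rewrite exchange_big big1 //= => r _.
transitivity (cof r * \sum_(j in J) (-1) ^+ rank_in J j * L r j * total_minor L (J :\ j)).
  by rewrite mulr_sumr; apply: eq_bigr => j _; ring.
pose M := \matrix_(a < k.+1, i < k.+1)
  L (if unlift ord0 a is Some a' then a' else r) (colenum hJ i).
have M0 : \det M = 0.
  apply: (@determinant_alternate _ _ _ ord0 (lift ord0 r)) => // i.
  by rewrite !mxE unlift_none liftK.
transitivity (cof r * \det M); last by rewrite M0 mulr0.
rewrite (expand_det_row _ ord0); congr (_ * _).
rewrite (reindex_onto (colenum hJ) (fun j => cast_ord hJ (enum_rank_in (colenum_in hJ ord0) j))); last first.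
  by move=> j jJ; rewrite /colenum cast_ordK enum_rankK_in.
apply: eq_big => [i|i _].
  rewrite colenum_in /=; apply/eqP/(@colenum_inj _ _ _ hJ).
  by rewrite /colenum cast_ordK enum_rankK_in ?enum_valP.
rewrite !mxE unlift_none /cofactor add0n rank_colenum.
have hJi : #|J :\ colenum hJ i| = k.
  by have := cardsD1 (colenum hJ i) J; rewrite colenum_in hJ => -[].
have JE : colenum hJ i |: (J :\ colenum hJ i) = J by rewrite finset.setD1K ?colenum_in.
have iN : colenum hJ i \notin J :\ colenum hJ i by rewrite !inE eqxx.
have rkE : i = rank_in (J :\ colenum hJ i) (colenum hJ i) :> nat.
  by rewrite -[LHS](rank_colenum hJ) -{1}JE rank_inU1 // ltnn.
suff lift_colenum : colenum hJ \o lift i =1 colenum hJi.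
  rewrite (minor_colenum L lift_colenum).
  have -> : row' ord0 (col' i M) = colsub (colenum hJ \o lift i) L.
    by apply/matrixP => a b; rewrite !mxE liftK.
  by rewrite mulrAC [RHS]mulrC.
move=> b /=.
have hJ' : #|colenum hJ i |: (J :\ colenum hJ i)| = k.+1 by rewrite JE.
transitivity (colenum hJ' (lift i b)).
  exact: eq_colenum.
by rewrite (colenumU1 hJi hJ' (i0 := i)) // /insert_col liftK.
Qed.

End Minors.

(** * Functions satisfying the exchange relations are minors *)

Section Realization.
Variables (F : fieldType) (n k : nat).
Implicit Types (I J : {set 'I_n}) (p q : {set 'I_n} -> F).

Lemma exchange_card I a c : #|I| = k -> a \in I -> c \notin I ->
  #|c |: I :\ a| = k.
Proof.
move=> hI aI cI; rewrite cardsU1 !inE (negbTE cI) andbF /= add1n.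
by rewrite -hI (cardsD1 a I) aI.
Qed.

(** Induction on the number of elements of [J] outside [I0].  If there are at least
    two and [c] is one of them, the relation for J - c and I0 + c contains the
    term p(J) p(I0); every other term multiplies the value at a set with one
    element fewer outside [I0] by the value at a set with one element outside. *)
Lemma pluecker_unique p q I0 : pluecker_relations k p -> pluecker_relations k q ->
  #|I0| = k -> p I0 = q I0 -> p I0 != 0 ->
  (forall a c, a \in I0 -> c \notin I0 -> p (c |: I0 :\ a) = q (c |: I0 :\ a)) ->
  forall J, #|J| = k -> p J = q J.
Proof.
move=> relp relq hI0 pq0 p0 pq1 J.
have [m] := ubnP #|J :\: I0|; elim: m J => // m IHm J lem hJ.
have cardD : #|J :\: I0| = #|I0 :\: J|.
  have := cardsID I0 J; have := cardsID J I0; rewrite hJ hI0 finset.setIC => <-.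
  by move/addnI.
have [JI0|[c]] := set_0Vmem (J :\: I0).
  suff -> : J = I0 by [].
  by apply/eqP; rewrite eqEcard hI0 hJ leqnn andbT -finset.setD_eq0 JI0.
move=> cJI0; have /setDP[cJ cI0] := cJI0.
have [one|more] := leqP #|J :\: I0| 1.
  have J1 : #|J :\: I0| == 1%N.
    by rewrite eqn_leq one; apply/card_gt0P; exists c.
  have I1 : #|I0 :\: J| == 1%N by rewrite -cardD.
  have /cards1P[c' c'E] := J1; have /cards1P[a aE] := I1.
  have c'c : c' = c by move: cJI0; rewrite c'E inE => /eqP.
  subst c'.
  have aI : a \in I0 :\: J by rewrite aE inE.
  have -> : J = c |: I0 :\ a; last by have /setDP[? ?] := aI; exact: pq1.
  apply/setP => x; move/setP/(_ x): c'E; move/setP/(_ x): aE; rewrite !inE.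
  by case: (x \in J) (x \in I0) (x == a) (x == c) => [] [] [] [].
(* The term of c in the relation for J - c and I0 + c, isolated. *)
have c_only (r : {set 'I_n} -> F) : pluecker_relations k r ->
  (-1) ^+ (rank_in (J :\ c) c + rank_in (c |: I0) c) * r J * r I0 =
  - \sum_(j in I0 :\: J) (-1) ^+ (rank_in (J :\ c) j + rank_in (c |: I0) j) *
     r (j |: J :\ c) * r ((c |: I0) :\ j).
  move=> relr; apply/eqP; rewrite -subr_eq0 opprK; apply/eqP.
  have hJc : #|J :\ c|.+1 = k by rewrite -hJ (cardsD1 c J) cJ.
  have hcI : #|c |: I0| = k.+1 by rewrite cardsU1 cI0 hI0.
  rewrite -[RHS](relr _ _ hJc hcI) [RHS](bigD1 c) /=; last by rewrite !inE eqxx.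
  rewrite finset.setD1K // finset.setU1K //; congr (_ + _).
  apply: eq_bigl => j; rewrite !inE.
  by case: eqVneq => [->|_]; rewrite ?cJ ?andbF ?andbT.
have step : \sum_(j in I0 :\: J) (-1) ^+ (rank_in (J :\ c) j + rank_in (c |: I0) j) *
     p (j |: J :\ c) * p ((c |: I0) :\ j) =
   \sum_(j in I0 :\: J) (-1) ^+ (rank_in (J :\ c) j + rank_in (c |: I0) j) *
     q (j |: J :\ c) * q ((c |: I0) :\ j).
  apply: eq_bigr => j /setDP[jI0 jJ].
  have cj : c != j by apply: contraNneq cI0 => ->.
  have -> : (c |: I0) :\ j = c |: I0 :\ j.
    by apply/setP => x; rewrite !inE; case: eqVneq => [->|]; rewrite ?(negbTE cj) // eq_sym (negbTE cj).
  rewrite (pq1 _ _ jI0 cI0) IHm //; last by apply: exchange_card.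
  have : (j |: J :\ c) :\: I0 = (J :\: I0) :\ c.
    apply/setP => x; rewrite !inE; case: (eqVneq x j) => [->|] /=; first by rewrite jI0 andbF.
    by move=> _; case: (x == c); rewrite ?andbF.
  by move=> ->; move: lem; rewrite (cardsD1 c) cJI0.
have := c_only p relp; rewrite step -(c_only q relq) -!mulrA => /(mulfI (negbT (signr_eq0 _ _))).
by rewrite pq0; apply: mulIf; rewrite -pq0.
Qed.

(** The matrix is normalized to be the identity on the columns [I0].  Its minor at
    c + I0 - a is then, up to sign, the entry of the column [c] in the row of
    [a], so these entries are forced, and [pluecker_unique] yields all other
    minors. *)
Lemma pluecker_matrix q I0 : pluecker_relations k q -> #|I0| = k -> q I0 = 1 ->
  exists L : 'M[F]_(k, n), forall J, #|J| = k -> q J = total_minor L J.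
Proof.
move=> relq hI0 q0.
pose entry a c : F := if c \in I0 then (c == a)%:R else
  (-1) ^+ (rank_in (I0 :\ a) c + rank_in (I0 :\ a) a) * q (c |: I0 :\ a).
pose L : 'M[F]_(k, n) := \matrix_(r, c) entry (colenum hI0 r) c.
have L0 : total_minor L I0 = 1.
  rewrite (minor_colenum L (frefl (colenum hI0))) -(det1 F k); congr (\det _).
  by apply/matrixP => r i; rewrite !mxE /entry colenum_in (inj_eq (@colenum_inj _ _ _ hI0)) eq_sym.
exists L; apply: (pluecker_unique relq (minor_pluecker L) hI0).
- by rewrite L0.
- by rewrite q0 oner_neq0.
move=> a c aI0 cI0.
have hIa : #|I0 :\ a|.+1 = k by rewrite -hI0 (cardsD1 a I0) aI0.
have [cof [cofN cof0]] := minor_linear L hIa.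
have [s as_] := colenum_onto hI0 aI0.
(* The column b is a unit vector for b in I0. *)
have pick_cof b r : b = colenum hI0 r -> \sum_i L i b * cof i = cof r.
  move=> br; rewrite (bigD1 r) //= big1 ?addr0.
    by rewrite mxE /entry br colenum_in eqxx mul1r.
  move=> i ir; rewrite mxE /entry br colenum_in (inj_eq (@colenum_inj _ _ _ hI0)).
  by rewrite eq_sym (negbTE ir) mul0r.
have cof_s : cof s = (-1) ^+ rank_in (I0 :\ a) a.
  have := cofN a; rewrite !inE eqxx finset.setD1K // L0 (pick_cof _ _ as_) => /(_ isT) e1.
  apply: (mulfI (negbT (signr_eq0 F (rank_in (I0 :\ a) a)))).
  by rewrite -e1 -expr2 sqrr_sign.
rewrite cofN ?inE ?negb_and ?cI0 ?orbT // (bigD1 s) //= big1 ?addr0; last first.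
  move=> i is_; rewrite -(pick_cof (colenum hI0 i) i) // cof0 ?mulr0 //.
  by rewrite !inE colenum_in as_ (inj_eq (@colenum_inj _ _ _ hI0)) is_.
rewrite mxE /entry (negbTE cI0) cof_s -as_ exprD.
set x := (-1) ^+ _; set y := (-1) ^+ _.
have -> : x * (x * y * q (c |: I0 :\ a) * y) = (x ^+ 2) * (y ^+ 2) * q (c |: I0 :\ a) by ring.
by rewrite !sqrr_sign !mul1r.
Qed.

Lemma dim_row_span (L : 'M[F]_(k, n)) : \rank L = k -> \dim (row_span L) = k.
Proof.
move=> rkL; have Lfree : row_free L by apply/eqP.
pose X : k.-tuple 'rV[F]_n := [tuple row i L | i < k].
have -> : row_span L = <<X>>%VS by rewrite /row_span; congr (<<_>>%VS).
suff /eqP -> : free X by rewrite size_tuple.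
apply/freeP => f; under eq_bigr do rewrite -tnth_nth tnth_mktuple.
move=> f0 i; have : \row_j f j *m L = 0 *m L.
  by rewrite mul0mx mulmx_sum_row -[RHS]f0; apply: eq_bigr => j _; rewrite mxE.
by move/(row_free_inj Lfree)/rowP/(_ i); rewrite !mxE.
Qed.

Theorem pluecker_relations_realized p I0 : pluecker_relations k p -> #|I0| = k ->
  p I0 != 0 -> pluecker_of_grassmannian_point k p.
Proof.
move=> relp hI0 p0.
have relq : pluecker_relations k (fun I => p I / p I0).
  move=> I J hI hJ; rewrite -[RHS](mulr0 ((p I0)^-1 ^+ 2)) -[in RHS](relp I J hI hJ).
  by rewrite mulr_sumr; apply: eq_bigr => j _; ring.
have [L LE] := pluecker_matrix relq hI0 (divff p0).
have rkL : \rank L = k.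
  apply/eqP; rewrite eqn_leq rank_leq_row /=.
  have := LE _ hI0; rewrite divff // (minor_colenum L (frefl (colenum hI0))) => L1.
  have Cu : colsub (colenum hI0) L \in unitmx by rewrite unitmxE -L1 unitr1.
  rewrite -[X in (X <= _)%N](mxrank_unit Cu).
  by rewrite -[L in colsub _ L]mulmx1 -mulmx_colsub mxrankM_maxl.
exists (row_span L); split; first exact: dim_row_span.
exists L, (p I0); split=> // I hI.
by rewrite -minorE -LE // mulrCA divff // mulr1.
Qed.

End Realization.

(** * Paths formed by two involutions *)

Section TwoInvolutions.
Variables (T : finType) (B : {set T}).
Implicit Types (f g : T -> T) (S : {set T}).

(** The shape of a perfect matching seen as an involution: an uncovered vertex is a
    fixed point, and all these are white, that is, outside [B]. *)
Definition colour_pairing f : Prop :=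
  [/\ involutive f, forall x, x \in B -> f x != x
    & forall x, f x != x -> (f x \in B) = (x \notin B)].

(** The points of [S] in [B] are matched with the points of [S] outside [B] that
    are not fixed. *)
Lemma fixed_points_count f S : colour_pairing f ->
  (forall x, x \in S -> f x \in S) ->
  (#|[set x in S | f x == x]| + #|S :&: B|.*2)%N = #|S|.
Proof.
move=> [fK fB fcol] fS.
have -> : #|S| = (#|S :&: B| + #|S :\: B|)%N by rewrite cardsID.
rewrite -(cardsID [set x | f x == x] (S :\: B)) -addnn addnC -!addnA; congr (_ + _)%N.
rewrite addnC; congr (_ + _)%N.
  apply: eq_card => x; rewrite !inE; case: (eqVneq (f x) x) => [fx|]; rewrite ?andbF //.
  by case: (boolP (x \in B)) => [/fB|]; rewrite ?fx ?eqxx ?andbT.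
rewrite -(card_imset _ (inv_inj fK)); apply: eq_card => x; rewrite !inE.
apply/imsetP/idP => [[y]|].
  rewrite inE => /andP[yS yB] ->; rewrite fK eq_sym (fB _ yB) fS //.
  by rewrite fcol ?fB // yB.
case/and3P => fx xB xS; exists (f x); last by rewrite fK.
by rewrite inE fS // fcol.
Qed.

Lemma fixed_points_balance f g S : colour_pairing f -> colour_pairing g ->
  (forall x, x \in S -> f x \in S) -> (forall x, x \in S -> g x \in S) ->
  #|[set x in S | f x == x]| = #|[set x in S | g x == x]|.
Proof.
move=> mf mg fS gS; apply/eqP.
by rewrite -(eqn_add2r #|S :&: B|.*2) !fixed_points_count.
Qed.

(** The component of [j] under two involutions [f] and [g] is the orbit of [j] under
    p = g o f, on which [g] acts as the reflection p^i j -> p^-i j and [f] as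
    p^i j -> p^(-i-1) j.  If the orbit has odd size m, each reflection has exactly
    one fixed point; if m is even, one has two fixed points and the other none,
    and the colour balance excludes this. *)
Lemma component_ends f g (h : rel T) j :
  colour_pairing f -> colour_pairing g ->
  (forall x y, h x y -> y = f x \/ y = g x) ->
  (forall x, connect h x (f x)) -> (forall x, connect h x (g x)) ->
  f j != j -> g j = j ->
  exists j', [/\ connect h j j', f j' = j', g j' != j',
    forall x, connect h j x -> f x = x -> x = j'
    & forall x, connect h j x -> g x = x -> x = j].
Proof.
move=> mf mg hfg hf hg fj gj; have [fK _ _] := mf; have [gK _ _] := mg.
pose p := g \o f.
have pI : injective p by apply: inj_comp; exact: inv_inj.
pose m := order p j.
have pgp x : p (g (p x)) = g x by rewrite /p /= gK fK.
have piter i x : iter i p (g (iter i p x)) = g x.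
  by elim: i x => // i IHi x; rewrite iterSr [iter i.+1 p x]iterS pgp IHi.
have fE x : f x = g (p x) by rewrite /p /= gK.
(* The orbit of j is closed under f and g, so it exhausts the component. *)
have orb x : connect h j x -> exists2 i, (i < m)%N & x = iter i p j.
  move=> /connectP[s hs ->]; suff : fconnect p j (last j s).
    by move=> jx; exists (findex p j (last j s)); rewrite ?findex_max // iter_findex.
  have closed_g x' : fconnect p j x' -> fconnect p j (g x').
    move=> /iter_findex <-; move: (findex _ _ _) => i.
    have := fconnect_iter p i (g (iter i p j)).
    by rewrite piter gj (fconnect_sym pI).
  have closed_f x' : fconnect p j x' -> fconnect p j (f x').
    move=> jx; rewrite fE; apply: closed_g; apply: (connect_trans jx).
    exact: fconnect1.
  suff H x' : fconnect p j x' -> path h x' s -> fconnect p j (last x' s).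
    by apply: H.
  elim: s x' {hs} => //= y s IHs x' jx' /andP[/hfg xy ys].
  by apply: IHs => //; case: xy => ->; [exact: closed_f|exact: closed_g].
(* A multiple of the period m below 2m is 0 or m. *)
have period a : (a < m + m)%N -> iter a p j = j -> a = 0%N \/ a = m.
  move=> am aj; have [am'|ma] := ltnP a m.
    by left; rewrite -(findex_iter am') aj findex0.
  right; have := findex_iter (f := p) (x := j) (i := a - m).
  rewrite -/m ltn_subLR // am => /(_ isT); rewrite -[in iter _ _ _](iter_order pI j).
  rewrite -/m -iterD subnK // aj findex0 => /esym/eqP; rewrite subn_eq0 => am'.
  by apply/eqP; rewrite eqn_leq am' ma.
have gfix i : (i < m)%N -> g (iter i p j) = iter i p j -> i = 0%N \/ (i + i)%N = m.
  move=> im gx; have := piter i j; rewrite gx gj -iterD => /period[|/eqP|]; last by right.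
    by rewrite -addnS leq_add // ltnW.
  by rewrite addn_eq0 andbb => /eqP; left.
have ffix i : (i < m)%N -> f (iter i p j) = iter i p j -> (i.+1 + i)%N = m.
  move=> im fx; have := piter i.+1 j; rewrite /= -fE fx gj -iterS -iterD.
  by move=> /period[|//|//]; rewrite -addnS; exact: leq_add.
pose C := [set x | connect h j x].
have Cf x : x \in C -> f x \in C by rewrite !inE => /connect_trans; apply.
have Cg x : x \in C -> g x \in C by rewrite !inE => /connect_trans; apply.
(* As g fixes j, balance provides a fixed point of f, which makes m odd. *)
have [j' j'P] : exists j', j' \in [set x in C | f x == x].
  apply/set0Pn; rewrite -card_gt0 (fixed_points_balance mf mg Cf Cg) card_gt0.
  by apply/set0Pn; exists j; rewrite !inE connect0 gj eqxx.
move: j'P; rewrite !inE => /andP[jj' /eqP fj'].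
have [i0 i0m j'E] := orb _ jj'.
have mE : (i0.+1 + i0)%N = m by apply: ffix => //; rewrite -j'E.
have gu x : connect h j x -> g x = x -> x = j.
  move=> jx gx; have [i im xE] := orb _ jx.
  have [|i0'|im'] := gfix i im; first by rewrite -xE.
    by rewrite xE i0'.
  by have := congr1 odd mE; rewrite -im' addSn /= !addnn !odd_double.
exists j'; split=> //.
  by apply: contraNneq fj => gj'; rewrite -(gu _ jj' gj') fj'.
move=> x jx fx; have [i im xE] := orb _ jx.
have := ffix i im; rewrite -xE => /(_ fx); rewrite -mE !addSn !addnn => -[/double_inj ii0].
by rewrite xE j'E ii0.
Qed.

End TwoInvolutions.

(** * Superposition of two perfect matchings *)

Section Superposition.
Variables (n : nat) (G : bgraph n).
Implicit Types (M E : {set {set G}}) (v w : G) (e C : {set G}).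

Definition degree M v : nat := #|[set e in M | v \in e]|.

Definition matching M : Prop := M \subset edges G /\ forall v, (degree M v <= 1)%N.

Definition covered M v : bool := [exists e in M, v \in e].

Lemma covered_degree M v : covered M v = (0 < degree M v)%N.
Proof.
apply/existsP/card_gt0P => [[e /andP[eM ve]]|[e]].
  by exists e; rewrite inE eM.
by rewrite inE => evM; exists e.
Qed.

Definition partner M v : G := odflt v [pick w | (w != v) && ([set v; w] \in M)].

Lemma matching_inj M e e' v : matching M -> e \in M -> e' \in M ->
  v \in e -> v \in e' -> e = e'.
Proof.
move=> [_ /(_ v)/card_le1P deg1] eM e'M ve ve'.
have /deg1 : e \in [set e in M | v \in e] by rewrite inE eM.
by move=> /(_ e'); rewrite !inE e'M ve' => /esym/eqP.
Qed.

Lemma partner_edge M v w : matching M -> v != w -> [set v; w] \in M -> partner M v = w.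
Proof.
move=> mM vw vwM; rewrite /partner; case: pickP => [u /andP[uv vuM]|/(_ w)] /=.
  have /setP/(_ u) : [set v; u] = [set v; w].
    by apply: (matching_inj (v := v) mM); rewrite ?inE ?eqxx.
  by rewrite !inE eqxx (negbTE uv) /= => /esym/eqP.
by rewrite eq_sym vw vwM.
Qed.

Lemma partner_moved M v : partner M v != v -> [set v; partner M v] \in M.
Proof.
by rewrite /partner; case: pickP => [w /andP[]|] //=; rewrite eqxx.
Qed.

Lemma partner_fixed M v : matching M -> (partner M v == v) = ~~ covered M v.
Proof.
move=> mM; apply/eqP/negP => [pv|].
  move=> /existsP[e /andP[eM ve]].
  have /edgesP[x [y [/adj_neq xy exy]]] := fintype.subsetP mM.1 e eM; subst e.
  move: ve; rewrite !inE => /orP[]/eqP vE; subst v.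
    by have := partner_edge mM xy eM; rewrite pv => yx; rewrite yx eqxx in xy.
  rewrite eq_sym in xy; rewrite finset.setUC in eM.
  by have := partner_edge mM xy eM; rewrite pv => yx; rewrite yx eqxx in xy.
move=> nc; apply/eqP/negPn/negP => /partner_moved vM; apply: nc.
by apply/existsP; exists [set v; partner M v]; rewrite vM !inE eqxx.
Qed.

Lemma partnerK M : matching M -> involutive (partner M).
Proof.
move=> mM v; have [pv|pv] := eqVneq (partner M v) v; first by rewrite !pv.
by apply: partner_edge => //; rewrite finset.setUC partner_moved.
Qed.

Lemma partner_adj M v : matching M -> partner M v != v -> adj v (partner M v).
Proof. by move=> mM /partner_moved vM; apply/edge_adj/(fintype.subsetP mM.1). Qed.

Variable black : {set G}.
Hypothesis bipartite : two_colouring black.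
Hypothesis boundary_white : forall v, v \in boundary G -> v \notin black.

Lemma pm_matching M : perfect_matching M -> matching M.
Proof.
case/and3P => ME /forall_inP int /forall_inP bnd; split=> // v.
have [vB|vB] := boolP (v \in boundary G); first exact: bnd.
by rewrite /degree (eqP (int v _)) // inE.
Qed.

Lemma pm_covered M v : perfect_matching M -> v \notin boundary G -> covered M v.
Proof.
case/and3P => _ /forall_inP int _ vB.
by rewrite covered_degree /degree (eqP (int v _)) // inE.
Qed.

Lemma perfect_matchingP M : reflect
  (matching M /\ forall v, v \notin boundary G -> covered M v) (perfect_matching M).
Proof.
apply: (iffP idP) => [pM|[[ME deg1] cov]].
  by split; [exact: pm_matching|move=> v; exact: pm_covered].
apply/and3P; split=> //; apply/forall_inP => v; last by move=> _; exact: deg1.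
rewrite inE => /cov; rewrite covered_degree => c1.
by apply/eqP/anti_leq; rewrite deg1.
Qed.

Lemma partner_colours M : perfect_matching M -> colour_pairing black (partner M).
Proof.
move=> pM; have mM := pm_matching pM; split=> [|x xB|x px]; first exact: partnerK.
  rewrite partner_fixed // negbK; apply: pm_covered => //.
  by apply: contraTN xB => /boundary_white.
have := bipartite (partner_adj mM px).
by case: (x \in black); case: (partner M x \in black).
Qed.

Definition linked E v w : bool := connect (fun x y => [set x; y] \in E) v w.

Lemma linked_sym E : symmetric (linked E).
Proof. by apply: sym_connect_sym => x y; rewrite finset.setUC. Qed.

Lemma linked_partner M M' v : linked (M :|: M') v (partner M v).
Proof.
have [->|pv] := eqVneq (partner M v) v; first exact: connect0.
by apply: connect1; rewrite inE partner_moved.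
Qed.

Lemma matching_pair M x y : matching M -> [set x; y] \in M -> x != y.
Proof. by move=> mM /(fintype.subsetP mM.1)/edge_adj/adj_neq. Qed.

Lemma linked_step M M' x y : matching M -> matching M' ->
  [set x; y] \in M :|: M' -> y = partner M x \/ y = partner M' x.
Proof.
move=> mM mM' /setUP[xyM|xyM].
  by left; rewrite (partner_edge mM (matching_pair mM xyM)).
by right; rewrite (partner_edge mM' (matching_pair mM' xyM)).
Qed.

(** An end of a path in the superposition is a vertex that one of the two matchings
    leaves uncovered; a path that starts at a vertex not covered by [M'] ends at
    a vertex not covered by [M]. *)
Lemma superposition_path M M' v :
  perfect_matching M -> perfect_matching M' -> covered M v -> ~~ covered M' v ->
  exists v', [/\ linked (M :|: M') v v', ~~ covered M v', covered M' v' &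
    forall w, linked (M :|: M') v w -> w != v -> w != v' ->
      covered M w && covered M' w].
Proof.
move=> pM pM' vM vM'; have mM := pm_matching pM; have mM' := pm_matching pM'.
have [x y|x|x|||v' [vv' fv' gv' fu gu]] := component_ends (j := v)
  (h := fun x y => [set x; y] \in M :|: M') (partner_colours pM) (partner_colours pM').
- exact: linked_step.
- exact: linked_partner.
- by rewrite finset.setUC; exact: linked_partner.
- by rewrite partner_fixed // negbK.
- by apply/eqP; rewrite partner_fixed.
exists v'; split=> //; first by rewrite -partner_fixed // fv'.
  by rewrite -[covered _ _]negbK -partner_fixed.
move=> w vw wv wv'; rewrite -[covered M w]negbK -[covered M' w]negbK.
rewrite -!partner_fixed //; apply/andP; split.
  by apply: contraNneq wv' => /(fu w vw)->.
by apply: contraNneq wv => /(gu w vw)->.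
Qed.

Definition meets C e : bool := e :&: C != finset.set0.

(** Follows [M'] on the edges that meet [C] and [M] elsewhere. *)
Definition splice C M M' : {set {set G}} :=
  [set e | e \in if meets C e then M' else M].

Lemma splice_union C M M' : splice C M M' :|: splice C M' M = M :|: M'.
Proof. by apply/setP => e; rewrite !inE; case: ifP; rewrite // orbC. Qed.

Lemma spliceK C M M' : splice C (splice C M M') (splice C M' M) = M.
Proof. by apply/setP => e; rewrite !inE; case: ifP; rewrite inE => ->. Qed.

(** Splicing is used along a component of the superposition.  No edge of [M] or
    [M'] leaves a component, so the spliced set looks like one of the two
    matchings around each vertex. *)
Section Splice.
Variables (M M' : {set {set G}}) (u : G).
Let C := [set w | linked (M :|: M') u w].

Lemma meets_component e v : e \in edges G -> e \in M :|: M' -> v \in e ->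
  meets C e = (v \in C).
Proof.
move=> /edgesP[x [y [_ ->]]] xyM.
have xyC : (x \in C) = (y \in C).
  rewrite !inE; apply/idP/idP => /connect_trans; apply; apply: connect1 => //.
  by rewrite finset.setUC.
have mE : meets C [set x; y] = (x \in C).
  apply/finset.set0Pn/idP => [[w]|xC]; last by exists x; rewrite finset.in_setI set21.
  by rewrite finset.in_setI => /andP[/set2P[->|->]] //; rewrite xyC.
by rewrite mE => /set2P[->|->].
Qed.

Lemma degree_splice v : matching M -> matching M' ->
  degree (splice C M M') v = degree (if v \in C then M' else M) v.
Proof.
move=> [ME _] [M'E _]; apply: eq_card => e; rewrite !inE.
case: (boolP (v \in e)) => ve; rewrite ?andbF // !andbT.
have [eMM'|] := boolP (e \in M :|: M'); last first.
  by rewrite inE negb_or => /andP[/negbTE eM /negbTE eM']; do 2 case: ifP; rewrite ?eM ?eM'.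
have eG : e \in edges G.
  by case/setUP: eMM' => [/(fintype.subsetP ME)|/(fintype.subsetP M'E)].
by rewrite (meets_component eG eMM' ve) inE.
Qed.

Lemma covered_splice v : matching M -> matching M' ->
  covered (splice C M M') v = covered (if v \in C then M' else M) v.
Proof. by move=> mM mM'; rewrite !covered_degree degree_splice. Qed.

Lemma splice_pm : perfect_matching M -> perfect_matching M' ->
  perfect_matching (splice C M M').
Proof.
move=> /perfect_matchingP[mM cM] /perfect_matchingP[mM' cM'].
apply/perfect_matchingP; split=> [|v vB].
  split=> [|v]; last by rewrite degree_splice //; case: ifP => _; [apply mM'.2|apply mM.2].
  apply/fintype.subsetP => e; rewrite inE; case: ifP => _; apply/fintype.subsetP.
    exact: mM'.1.
  exact: mM.1.
by rewrite covered_splice //; case: ifP => _; [exact: cM'|exact: cM].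
Qed.

End Splice.
End Superposition.

(** * Exchange relations for matchings *)

Section DimerPluecker.
Variables (F : numFieldType) (n : nat) (G : bgraph n) (black : {set G}).
Hypothesis bipartite : two_colouring black.
Hypothesis boundary_white : forall v : G, v \in boundary G -> v \notin black.
Hypothesis planar : forall (E : {set {set G}}) (i0 i1 i2 i3 : 'I_n), E \subset edges G ->
  (i0 < i1)%N -> (i1 < i2)%N -> (i2 < i3)%N ->
  linked E (bdry G i0) (bdry G i2) -> linked E (bdry G i1) (bdry G i3) ->
  linked E (bdry G i0) (bdry G i1).
Implicit Types (M : {set {set G}}) (I J : {set 'I_n}) (j x : 'I_n).

Local Notation b := (bdry G).

Definition dimer_configs I : {set {set {set G}}} :=
  [set M | perfect_matching M & [forall x, covered M (b x) == (x \in I)]].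

Lemma dimer_configsP I M : reflect
  (perfect_matching M /\ forall x, covered M (b x) = (x \in I)) (M \in dimer_configs I).
Proof.
rewrite inE; apply: (iffP andP) => -[pM cM]; split=> //.
  by move=> x; rewrite (eqP (fintype.forallP cM x)).
by apply/fintype.forallP => x; rewrite cM.
Qed.

Lemma dimersE I : dimers [set b j | j in I] = #|dimer_configs I|.
Proof.
apply: eq_card => M; rewrite !inE; congr (_ && _).
apply/eqP/fintype.forallP => [/setP mI x|cM].
  by have := mI (b x); rewrite inE bdry_boundary (mem_imset _ _ (@bdry_inj _ G)) => /= <-.
apply/setP => v; rewrite inE; apply/andP/imsetP => [[/imsetP[x _ ->] cv]|[x xI ->]].
  by exists x; rewrite // -(eqP (cM x)).
by rewrite bdry_boundary -/(covered M (b x)) (eqP (cM x)).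
Qed.

(** Inner boundary vertices of the path from [j] are covered by both matchings, so
    they belong to both boundary sets; the far end lies in J \ I. *)
Lemma other_end I J j M M' : j \notin I -> j \in J ->
  M \in dimer_configs (j |: I) -> M' \in dimer_configs (J :\ j) ->
  exists j', [/\ j' \in J :\: I, j' != j, linked (M :|: M') (b j) (b j') &
    forall x, linked (M :|: M') (b j) (b x) -> x != j -> x != j' ->
      (x \in I) && (x \in J)].
Proof.
move=> jI jJ /dimer_configsP[pM cM] /dimer_configsP[pM' cM'].
have [||v [jv Mv M'v inner]] := superposition_path bipartite boundary_white (v := b j) pM pM'.
- by rewrite cM !inE eqxx.
- by rewrite cM' !inE eqxx.
have : v \in boundary G by apply: contraNT Mv => /(pm_covered pM).
case/imsetP => j' _ vj'; subst v; move: Mv M'v.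
rewrite cM cM' !inE negb_or => /andP[j'j j'I] /andP[_ j'J].
exists j'; split=> //; first by rewrite !inE j'I.
move=> x jx xj xj'; have := inner (b x) jx; rewrite !(inj_eq (@bdry_inj _ G)).
by rewrite xj xj' cM cM' !inE (negbTE xj) => /(_ isT isT).
Qed.

Section Between.
Variables (M M' : {set {set G}}) (I J : {set 'I_n}) (j j' : 'I_n).
Hypotheses (jI : j \notin I) (jJ : j \in J) (j'I : j' \notin I).
Hypotheses (Mdim : M \in dimer_configs (j |: I)) (M'dim : M' \in dimer_configs (J :\ j)).
Hypothesis jj' : linked (M :|: M') (b j) (b j').
Hypothesis ltjj' : (j < j')%N.

Let btw x := (j < x < j')%N.

Lemma path_through x : linked (M :|: M') (b j) (b x) -> x != j -> x != j' ->
  (x \in I) && (x \in J).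
Proof.
have [u [_ _ _ inner]] := other_end jI jJ Mdim M'dim.
suff -> : j' = u by exact: inner.
apply/eqP/negPn/negP => j'u; have := inner j' jj'.
by rewrite (negbTE j'I) neq_ltn ltjj' orbT => /(_ isT j'u).
Qed.

(** Boundary vertices between [j] and [j'] on the path from [j] are in both [I]
    and [J].  The components of the others meet the boundary only between [j]
    and [j'], by planarity, so the colour balance on their union [U] compares
    the elements missing from [I] with those missing from [J]. *)
Lemma card_between : #|[set x in I | btw x]| = #|[set x in J | btw x]|.
Proof.
have [/dimer_configsP[pM cM] /dimer_configsP[pM' cM']] := (Mdim, M'dim).
have mM := pm_matching pM; have mM' := pm_matching pM'.
pose E := M :|: M'.
have EG : E \subset edges G by rewrite finset.subUset mM.1 mM'.1.
pose off x := btw x && ~~ linked E (b j) (b x).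
pose U : {set G} := [set v | [exists x, off x && linked E (b x) v]].
have Uclosed M0 : (forall v, linked E v (partner M0 v)) ->
    forall v, v \in U -> partner M0 v \in U.
  move=> lM0 v; rewrite !inE => /existsP[x /andP[ox xv]]; apply/existsP; exists x.
  by rewrite ox; apply: connect_trans xv (lM0 v).
(* A link from between to outside would cross the path from j to j'. *)
have Ubdry x : (b x \in U) = off x.
  rewrite inE; apply/existsP/idP => [[y /andP[/andP[/andP[jy yj'] njy] yx]]|ox]; last first.
    by exists x; rewrite ox; exact: connect0.
  have njx : ~~ linked E (b j) (b x).
    apply: contra njy => jx; apply: (connect_trans jx); rewrite -/(linked _ _ _).
    by rewrite linked_sym.
  rewrite /off njx andbT /btw; apply/andP; split; rewrite ltnNge leq_eqVlt negb_or.
    apply/andP; split; first by apply: contraNneq njx => /val_inj->; exact: connect0.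
    apply/negP => xj; case/negP: njx; rewrite linked_sym.
    by apply: (planar EG xj jy yj') => //; rewrite linked_sym.
  apply/andP; split; first by apply: contraNneq njx => /val_inj<-.
  by apply/negP => j'x; case/negP: njy; apply: (planar EG jy yj' j'x).
have fixE M0 (K : {set 'I_n}) : perfect_matching M0 -> (forall x, x != j -> covered M0 (b x) = (x \in K)) ->
    #|[set v in U | partner M0 v == v]| = #|[set x | off x] :\: K|.
  move=> pM0 cM0; rewrite -(card_imset _ (@bdry_inj _ G)); apply: eq_card => v.
  rewrite inE partner_fixed; last exact: pm_matching.
  apply/andP/imsetP => [[vU nv]|[x]].
    have : v \in boundary G by apply: contraNT nv => /(pm_covered pM0).
    case/imsetP => x _ vx; subst v; rewrite Ubdry in vU; exists x => //.
    rewrite !inE vU andbT -cM0 //; apply: contraTneq vU => ->.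
    by rewrite /off /btw ltnn.
  case/setDP; rewrite inE => ox xK ->; rewrite Ubdry ox cM0 //.
  by apply: contraTneq ox => ->; rewrite /off /btw ltnn.
have lM' v : linked E v (partner M' v) by rewrite /E finset.setUC; exact: linked_partner.
have := fixed_points_balance (partner_colours bipartite boundary_white pM)
  (partner_colours bipartite boundary_white pM')
  (Uclosed M (linked_partner M M')) (Uclosed M' lM').
rewrite (fixE M I pM) ?(fixE M' J pM'); first last.
- by move=> x xj; rewrite cM !inE (negbTE xj).
- by move=> x xj; rewrite cM' !inE xj.
have inside (K : {set 'I_n}) : (forall x, btw x -> ~~ off x -> x \in K) ->
    #|[set x in K | btw x]| = (#|[set x | off x] :&: K| + #|[set x | btw x && ~~ off x]|)%N.
  move=> onK; rewrite -(cardsID [set x | off x] [set x in K | btw x]); congr (_ + _)%N.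
    apply: eq_card => x; rewrite !inE /off; by case: (btw x); rewrite ?andbF ?andbT // andbC.
  apply: eq_card => x; rewrite !inE; case: (boolP (btw x)) => bx; rewrite ?andbF //= andbT.
  by case: (boolP (off x)) => //= ox; rewrite (onK x bx ox).
have on x : btw x -> ~~ off x -> (x \in I) && (x \in J).
  move=> bx; rewrite /off bx negbK => jx; have /andP[xj xj'] := bx.
  by apply: (path_through jx); rewrite neq_ltn ?xj ?xj' ?orbT.
have inI x : btw x -> ~~ off x -> x \in I by move=> bx ox; case/andP: (on x bx ox).
have inJ x : btw x -> ~~ off x -> x \in J by move=> bx ox; case/andP: (on x bx ox).
rewrite (inside _ inI) (inside _ inJ) => offIJ; congr (_ + _)%N.
apply/eqP; rewrite -(eqn_add2r #|[set x | off x] :\: I|) {2}offIJ.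
by rewrite !cardsID.
Qed.

End Between.

Definition linked_pairs I J j j' : {set {set {set G}} * {set {set G}}} :=
  [set P | [&& P.1 \in dimer_configs (j |: I), P.2 \in dimer_configs (J :\ j)
             & linked (P.1 :|: P.2) (b j) (b j')]].

(** Splicing changes which matching covers the two ends of the path and nothing
    else on the boundary: its inner boundary vertices are covered by both. *)
Lemma splice_linked_pairs I J j j' M M' : j \notin I -> j \in J ->
  j' \in J :\: I -> j' != j -> (M, M') \in linked_pairs I J j j' ->
  let C := [set w | linked (M :|: M') (b j) w] in
  (splice C M M', splice C M' M) \in linked_pairs I J j' j.
Proof.
move=> jI jJ /setDP[j'J j'I] j'j; rewrite inE /= => /and3P[Md M'd jj'].
have [u [_ uj ju inner]] := other_end jI jJ Md M'd.
have uE : u = j'.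
  apply/eqP; rewrite eq_sym; apply/negPn/negP => j'u.
  by have := inner j' jj' j'j j'u; rewrite (negbTE j'I).
subst u; set C := [set w | _]; rewrite inE /= splice_union linked_sym jj' andbT.
have /dimer_configsP[pM cM] := Md; have /dimer_configsP[pM' cM'] := M'd.
have mM := pm_matching pM; have mM' := pm_matching pM'.
have CE : C = [set w | linked (M' :|: M) (b j) w] by rewrite finset.setUC.
have bC x : (b x \in C) = linked (M :|: M') (b j) (b x) by rewrite inE.
have CI x : b x \in C -> x != j -> x != j' -> (x \in I) && (x \in J).
  by rewrite bC; exact: inner.
have Cj : b j \in C by rewrite bC; exact: connect0.
have Cj' : b j' \in C by rewrite bC.
apply/andP; split; apply/dimer_configsP; split.
- exact: splice_pm.
- move=> x; rewrite covered_splice // -/C.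
  case: (eqVneq x j) => [->|xj]; first by rewrite Cj cM' !inE eqxx eq_sym (negbTE j'j) (negbTE jI).
  case: (eqVneq x j') => [->|xj']; first by rewrite Cj' cM' !inE eqxx j'j j'J.
  case: ifP => [/CI/(_ xj xj')/andP[xI xJ]|_].
    by rewrite cM' !inE xj xI xJ orbT.
  by rewrite cM !inE (negbTE xj) (negbTE xj').
- by rewrite CE; exact: splice_pm.
move=> x; rewrite CE covered_splice // -CE.
case: (eqVneq x j) => [->|xj]; first by rewrite Cj cM !inE eqxx eq_sym j'j jJ.
case: (eqVneq x j') => [->|xj']; first by rewrite Cj' cM !inE eqxx (negbTE j'j) (negbTE j'I).
case: ifP => [/CI/(_ xj xj')/andP[xI xJ]|_].
  by rewrite cM !inE xj' xI xJ orbT.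
by rewrite cM' !inE xj xj'.
Qed.

Lemma linked_pairs_le I J j j' : j \notin I -> j \in J -> j' \in J :\: I -> j' != j ->
  (#|linked_pairs I J j j'| <= #|linked_pairs I J j' j|)%N.
Proof.
move=> jI jJ j'JI j'j.
pose swap (P : {set {set G}} * {set {set G}}) :=
  let C := [set w | linked (P.1 :|: P.2) (b j) w] in
  (splice C P.1 P.2, splice C P.2 P.1).
have swapK : involutive swap.
  by move=> [M M']; rewrite /swap /= splice_union !spliceK.
rewrite -(card_imset _ (inv_inj swapK)); apply: subset_leq_card.
apply/fintype.subsetP => _ /imsetP[[M M'] MM' ->].
exact: splice_linked_pairs.
Qed.

Lemma linked_pairs_sym I J j j' : j \in J :\: I -> j' \in J :\: I -> j' != j ->
  #|linked_pairs I J j j'| = #|linked_pairs I J j' j|.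
Proof.
move=> jJI j'JI j'j; have [[jJ jI] [j'J j'I]] := (setDP jJI, setDP j'JI).
by apply/eqP; rewrite eqn_leq !linked_pairs_le // eq_sym.
Qed.

Definition exchange_sign I J j : F := (-1) ^+ (rank_in I j + rank_in J j).

(** If there is a linked pair at all, the two ranks of the larger of [j] and [j']
    exceed those of the smaller by the numbers of elements of [I] and of [J]
    strictly between, which are equal, and by one more for [J], which contains
    the smaller one. *)
Lemma exchange_sign_flip I J j j' : j \in J :\: I -> j' \in J :\: I -> j' != j ->
  exchange_sign I J j' *+ #|linked_pairs I J j j'| =
  - (exchange_sign I J j *+ #|linked_pairs I J j j'|).
Proof.
wlog jj' : j j' / (j < j')%N => [flip|].
  move=> jJI j'JI j'j; case: (ltngtP j j') => [jj'|jj'|/val_inj jj'].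
  - exact: flip.
  - rewrite linked_pairs_sym // [X in - X]flip ?opprK // eq_sym //.
  - by rewrite jj' eqxx in j'j.
move=> /setDP[jJ jI] /setDP[j'J j'I] j'j.
have [->|[[M M']]] := set_0Vmem (linked_pairs I J j j'); first by rewrite cards0 oppr0.
rewrite inE => /and3P[/= Md M'd lj].
rewrite -mulNrn; congr (_ *+ _); rewrite /exchange_sign !(rank_in_between _ jj').
rewrite (card_between jI jJ j'I Md M'd lj jj') (negbTE jI) jJ addn0.
set s := #|_|; have ss : (-1) ^+ s * (-1) ^+ s = 1 :> F by rewrite -expr2 sqrr_sign.
by rewrite !exprD expr1; ring: ss.
Qed.

(** Sorts the pairs of matchings by the far end of the path that starts at [j]. *)
Lemma dimer_product I J j : j \in J :\: I ->
  (#|dimer_configs (j |: I)| * #|dimer_configs (J :\ j)|)%N =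
  \sum_(j' in J :\: I | j' != j) #|linked_pairs I J j j'|.
Proof.
move=> /setDP[jJ jI]; rewrite -cardsX -sum1_card.
transitivity (\sum_(P in finset.setX (dimer_configs (j |: I)) (dimer_configs (J :\ j)))
   \sum_(j' in J :\: I | j' != j) (linked (P.1 :|: P.2) (b j) (b j') : nat)).
  apply: eq_bigr => -[M M'] /setXP[Md M'd] /=.
  have [u [uJI uj ju inner]] := other_end jI jJ Md M'd.
  rewrite (bigD1 u) /=; last by rewrite uJI.
  rewrite ju big1 ?addn0 // => x /andP[/andP[/setDP[xJ xI] xj] xu].
  apply/eqP; rewrite eqb0; apply/negP => jx.
  by have := inner x jx xj xu; rewrite (negbTE xI).
rewrite exchange_big; apply: eq_bigr => j' _ /=; rewrite -sum1_card.
rewrite big_mkcond [RHS]big_mkcond /=; apply: eq_bigr => -[M M'] _.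
rewrite finset.in_setX [_ \in linked_pairs _ _ _ _]inE /=.
by case: (M \in _); case: (M' \in _); case: (linked _ _ _).
Qed.

(** Sorting each term by the far end j' turns the relation into a double sum over
    pairs (j, j'), which changes sign under exchange of j and j'. *)
Theorem dimers_pluecker k :
  pluecker_relations k (fun I => (dimers [set b j | j in I])%:R : F).
Proof.
move=> I J _ _.
pose term j j' := exchange_sign I J j *+ #|linked_pairs I J j j'|.
transitivity (\sum_(j in J :\: I) \sum_(j' in J :\: I | j' != j) term j j').
  apply: eq_bigr => j jJI; rewrite !dimersE -mulrA -natrM dimer_product //.
  by rewrite mulr_natr -sumrMnr.
set S := (X in X = 0).
suff : S = - S by move/eqP; rewrite -addr_eq0 -mulr2n mulrn_eq0 => /eqP.
rewrite {1}/S (exchange_big_dep (fun j' => j' \in J :\: I)) /=; last by move=> ? ? _ /andP[].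
rewrite /S -sumrN; apply: eq_bigr => j jJI; rewrite -sumrN.
apply: eq_big => [j'|j' /andP[j'JI jj']]; first by rewrite jJI /= eq_sym.
have j'j : j' != j by rewrite eq_sym; case/andP: jj'.
by rewrite /term -(linked_pairs_sym jJI j'JI j'j) exchange_sign_flip.
Qed.

End DimerPluecker.

Lemma noncrossing_linked (R : realType) (n : nat) (G : bgraph n)
    (E : {set {set G}}) (i0 i1 i2 i3 : 'I_n) :
  embedded_in_disc R G -> E \subset edges G ->
  (i0 < i1)%N -> (i1 < i2)%N -> (i2 < i3)%N ->
  linked E (bdry G i0) (bdry G i2) -> linked E (bdry G i1) (bdry G i3) ->
  linked E (bdry G i0) (bdry G i1).
Proof.
move=> emb /fintype.subsetP EG; apply: (noncrossing emb).
  by move=> x y /EG/edge_adj.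
by move=> x y; rewrite finset.setUC.
Qed.

Theorem corollary3p4 (R : realType) (N k n : nat) (G : bgraph n)
    (black : {set G})
    (hembedded : embedded_in_disc R G)
    (hbipartite : two_colouring black)
    (hboundary_white : forall v : G, v \in boundary G -> v \notin black)
    (hblack : #|black| = (N + k)%N)
    (hwhite : #|~: (black :|: boundary G)| = N) :
  (forall I : {set 'I_n}, #|I| = k -> dimers [set bdry G j | j in I] = 0%N) \/
  pluecker_of_grassmannian_point k
    (fun I : {set 'I_n} => (dimers [set bdry G j | j in I])%:R : R).
Proof.
have [allzero|/existsNP[I0 /not_implyP[hI0 /eqP nz]]] :=
    pselect (forall I : {set 'I_n}, #|I| = k -> dimers [set bdry G j | j in I] = 0%N).
  by left.
right; apply: (pluecker_relations_realized (I0 := I0)) => //; last by rewrite pnatr_eq0.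
apply: (dimers_pluecker R hbipartite hboundary_white).
by move=> E i0 i1 i2 i3 EG; exact: (noncrossing_linked hembedded).
Qed.
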